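(* \begin{itemize} \item For each convergent word sequence $(\boldsymbol{w}_n)_{n\to\infty}$ there is an $f\in\mathcal{W}$ such that $(\boldsymbol{w}_n)_{n\to\infty}$ converges to $f$. Moreover, if $(\boldsymbol{w}_n)_{n\to\infty}$ converges to $g$, then $f$ and $g$ are equal almost everywhere. \item Conversely, for every $f\in\mathcal{W}$ there is a word sequence $(\boldsymbol{w}_n)_{n\to\infty}$ which converges to $f$. \end{itemize}
   Context: Words are finite sequences over $\{0,1\}$. $\mathcal{W}$ is the set of all Lebesgue measurable functions $f:[0,1]\to[0,1]$, with functions identified when they are equal almost everywhere. For $\boldsymbol{w}\in\{0,1\}^n$ and $\boldsymbol{u}\in\{0,1\}^\ell$ (with $n\ge\ell$), $t(\boldsymbol{u},\boldsymbol{w})=\binom{\boldsymbol{w}}{\boldsymbol{u}}\binom n\ell^{-1}$, where $\binom{\boldsymbol{w}}{\boldsymbol{u}}$ is the number of sets $\{i_1<\dots<i_\ell\}\subseteq\{1,\dots,n\}$ with $w_{i_j}=u_j$ for all $j$. Throughout, word sequences are sequences of words whose lengths tend to infinity. A word sequence $(\boldsymbol{w}_n)_{n\to\infty}$ is convergent if for every finite word $\boldsymbol{u}$ the sequence $(t(\boldsymbol{u},\boldsymbol{w}_n))_{n\to\infty}$ converges. For $f:[0,1]\to[0,1]$ measurable write $f^1=f$, $f^0=1-f$ and, for $\boldsymbol{u}\in\{0,1\}^\ell$, \[t(\boldsymbol{u},f)=\ell!\int_{0\le x_1<\dots<x_\ell\le1}\prod_{i=1}^{\ell}f^{u_i}(x_i)\,dx_1\cdots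 dx_\ell.\] The sequence $(\boldsymbol{w}_n)_{n\to\infty}$ converges to $f$ if $\lim_{n\to\infty}t(\boldsymbol{u},\boldsymbol{w}_n)=t(\boldsymbol{u},f)$ for every finite word $\boldsymbol{u}$. *)

(* Defs.v *)
From HB Require Import structures.
From mathcomp Require Import all_boot all_order all_algebra.
From mathcomp Require Import all_classical all_reals all_analysis.
Import Order.TTheory GRing.Theory Num.Theory.
Import numFieldNormedType.Exports.

Set Implicit Arguments.
Unset Strict Implicit.
Unset Printing Implicit Defensive.

Local Open Scope classical_set_scope.
Local Open Scope ring_scope.

Definition word := seq bool.

(* [enum I] lists the indices of [I] in increasing order, so the condition
   says that [I] = {i_1 < ... < i_l} with l = size u and w_(i_j) = u_j. *)
Definition occurrences (u w : word) : nat :=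
  #|[set I : {set 'I_(size w)} |
      [seq tnth (in_tuple w) i | i <- enum I] == u]%SET|.

(* Only meaningful when [size u <= size w]; otherwise it is 0 / 0 = 0. *)
Definition word_density (R : realType) (u w : word) : R :=
  (occurrences u w)%:R / 'C(size w, size u)%:R.

Definition word_sequence (w : nat -> word) : Prop :=
  (fun n => size (w n)) @ \oo --> \oo.

Definition convergent (R : realType) (w : nat -> word) : Prop :=
  forall u : word, cvgn (fun n => word_density R u (w n)).

(* The real line with the sigma-algebra of Lebesgue measurable sets (and not
   only the Borel ones), on which [completed_lebesgue_measure] is defined. *)
Notation lebesgueTypeR R := (caratheodory_type (@wlength R idfun)^*%mu).

(* The product of the one-dimensional Lebesgue measure with a measure [m] on
   k-tuples, transported from R * R^k to (k+1)-tuples. *)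
Section cons_measure.
Context (R : realType) (k : nat).
Local Notation L := (lebesgueTypeR R).
Variable m : {sigma_finite_measure set (k.-tuple L) -> \bar R}.
Local Open Scope ereal_scope.

Let cons_pair (p : L * k.-tuple L) : k.+1.-tuple L := [tuple of p.1 :: p.2].

Let uncons (t : k.+1.-tuple L) : L * k.-tuple L :=
  (tnth t ord0, [tuple of behead t]).

Let cons_pairK : cancel cons_pair uncons.
Proof.
by case=> x t; rewrite /uncons /cons_pair/=; congr pair; exact: val_inj.
Qed.

Let measurable_cons_pair : measurable_fun setT cons_pair.
Proof.
exact: (@measurable_cons _ _ (L * k.-tuple L)%type L fst k snd
  measurable_fst measurable_snd).
Qed.

Let measurable_uncons : measurable_fun setT uncons.
Proof.
apply: measurable_fun_pair.
- exact: measurable_tnth.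
- exact: measurable_behead.
Qed.

Let p := [the {measure set _ -> \bar R} of
  (@completed_lebesgue_measure R \x m)].

Definition cons_measure : set (k.+1.-tuple L) -> \bar R :=
  pushforward (@completed_lebesgue_measure R \x m) cons_pair.

Let cons_measure0 : cons_measure set0 = 0.
Proof. by rewrite /cons_measure /pushforward preimage_set0 measure0. Qed.

Let cons_measure_ge0 A : 0 <= cons_measure A.
Proof. exact: (measure_ge0 p). Qed.

Let measurable_cons_pre A : measurable A -> measurable (cons_pair @^-1` A).
Proof.
by move=> mA; rewrite -[X in measurable X]setTI; exact: measurable_cons_pair.
Qed.

Let cons_measure_sigma_additive : semi_sigma_additive cons_measure.
Proof.
move=> F mF tF mUF; rewrite /cons_measure /pushforward preimage_bigcup.
apply: (@measure_semi_sigma_additive _ _ _ p).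
- by move=> n; exact: measurable_cons_pre.
- apply/trivIsetP => /= i j _ _ ij; rewrite -preimage_setI.
  by move/trivIsetP : tF => /(_ _ _ _ _ ij) ->//; rewrite preimage_set0.
- by rewrite -preimage_bigcup; exact: measurable_cons_pre.
Qed.

HB.instance Definition _ := isMeasure.Build _ _ _ cons_measure
  cons_measure0 cons_measure_ge0 cons_measure_sigma_additive.

Let cons_measure_sigma_finite : sigma_finite setT cons_measure.
Proof.
have /sigma_finiteP[F [TF ndF Foo]] :=
  sigma_finiteT (@completed_lebesgue_measure R).
have /sigma_finiteP[G [TG ndG Goo]] := sigma_finiteT m.
exists (fun n => uncons @^-1` (F n `*` G n)).
  rewrite -preimage_bigcup -(@preimage_setT _ _ uncons); congr (_ @^-1` _).
  rewrite -setXTT TF TG predeqE => -[x y]; split.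
    move=> [/= [n _ Fnx] [i _ Gky]]; exists (maxn n i) => //; split.
    - by move: x Fnx; exact/subsetPset/ndF/leq_maxl.
    - by move: y Gky; exact/subsetPset/ndG/leq_maxr.
  by move=> [n _ []/= ? ?]; split; exists n.
move=> n; have [mF Fn] := Foo n; have [mG Gn] := Goo n; split.
  rewrite -[X in measurable X]setTI.
  by apply: measurable_uncons => //; exact: measurableX.
rewrite /cons_measure /pushforward.
rewrite -comp_preimage (_ : uncons \o cons_pair = id) ?funeqE// preimage_id.
by rewrite product_measure1E// lte_mul_pinfty// ge0_fin_numE.
Qed.

HB.instance Definition _ := Measure_isSigmaFinite.Build _ _ _ cons_measure
  cons_measure_sigma_finite.

End cons_measure.

(* Lebesgue measure on R^l, as an iterated product. The sigma-algebra is the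
   product of the one-dimensional Lebesgue sigma-algebras; it is not completed,
   but it makes the integrand of [fun_density] measurable. *)
Fixpoint lebesgue_tuple (R : realType) (l : nat) :
    {sigma_finite_measure set (l.-tuple (lebesgueTypeR R)) -> \bar R} :=
  match l with
  | 0 => dirac ([tuple] : 0.-tuple (lebesgueTypeR R))
  | k.+1 => cons_measure (lebesgue_tuple R k)
  end.

(* Functions on [0, 1] are represented by functions on the whole line whose
   values outside [0, 1] are ignored. Elements are not quotiented: equality of
   elements is equality almost everywhere on [0, 1]. *)
Definition limit_space (R : realType) : set (R -> R) :=
  [set f | measurable_fun (`[0, 1] : set (lebesgueTypeR R))
             (f : lebesgueTypeR R -> R) /\
           forall x : R, 0 <= x <= 1 -> 0 <= f x <= 1].

Definition letter_fun (R : realType) (f : R -> R) (b : bool) (x : R) : R :=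
  if b then f x else 1 - f x.

Definition ordered_simplex (R : realType) (l : nat) :
    set (l.-tuple (lebesgueTypeR R)) :=
  [set x | (forall i : 'I_l, 0 <= (tnth x i : R) <= 1) /\
           (forall i j : 'I_l, (i < j)%N -> (tnth x i : R) < tnth x j)].

Definition fun_density (R : realType) (u : word) (f : R -> R) : R :=
  (size u)`!%:R *
  \int[lebesgue_tuple R (size u)]_(x in @ordered_simplex R (size u))
    \prod_(i < size u) letter_fun f (tnth (in_tuple u) i) (tnth x i).

Definition converges_to (R : realType) (w : nat -> word) (f : R -> R) : Prop :=
  forall u : word,
    word_density R u (w n) @[n --> \oo] --> fun_density u f.

(* Main.v *)
Require Import Defs.
From HB Require Import structures.
From mathcomp Require Import all_boot all_order all_algebra.
From mathcomp Require Import all_classical all_reals all_analysis.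
From mathcomp Require Import measurable_realfun.
From mathcomp Require Import ring lra zify.
Import Order.TTheory GRing.Theory Num.Theory.
Import numFieldNormedType.Exports.

Set Implicit Arguments.
Unset Strict Implicit.
Unset Printing Implicit Defensive.

Local Open Scope classical_set_scope.
Local Open Scope ring_scope.

(** The object that mediates between words and functions is the distribution
    function: for a function [f] it is the primitive [F x] of [f] from [0] to [x],
    and for a word of length [n] it is the number of letters 1 among the first
    [x n] letters, divided by [n]. Convergence of all densities turns out to be
    the same as convergence of distribution functions, and the three claims then
    become statements on monotone functions with slope at most one.

    From distribution functions to densities ([word_density_cvg]). Revealing the
    letters of [u] one at a time, the number of occurrences of [b :: u] in a
    suffix of [w] is a sum of the numbers of occurrences of [u] in shorter
    suffixes, over the positions of the letter [b]. The corresponding integrals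
    satisfy the same recursion with the sum replaced by an integral against the
    increments of [F]. Summation by parts bounds the difference by the uniform
    distance of the distribution functions.

    From densities to distribution functions ([word_cdf_determined]). Adding the
    densities of all words of length [k + 1] with first letter 1 gives, up to
    [o(1)], the [k]-th moment of the positions of the letter 1, measured from the
    right end. So the densities determine all polynomial statistics of these
    positions, and explicit polynomials close to a step function ([step_poly])
    determine the distribution function up to an arbitrarily small error.

    Existence of the limit: for a convergent sequence of words the distribution
    functions form a Cauchy sequence at each point. The limit [F] has slopes
    between [0] and [1], so its Stieltjes measure lies below the Lebesgue measure
    and its Radon-Nikodym density is the required function ([cdf_density]).
    Converse: rounding [n F] to integers yields words whose distribution function
    is within [1 / n] of [F] ([rounded_word_close]). Uniqueness: if the sequence
    also converges to [g], compare it with the words obtained by rounding the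
    primitive of [g]; they have the same limit densities, so the primitives of
    [f] and [g] agree, and then so do [f] and [g] almost everywhere
    ([cdf_determines_function]). *)

(** * Occurrences of a word *)

Lemma map_enum_cons (a : bool) (w : word) (I : {set 'I_(size w).+1}) :
  [seq tnth (in_tuple (a :: w)) i | i <- enum I] =
  (if ord0 \in I then [:: a] else [::]) ++
  [seq tnth (in_tuple w) j | j <- enum [set j | lift ord0 j \in I]%SET].
Proof.
rewrite {1}/enum_mem -enumT enum_ordSl /= filter_map.
have -> : enum [set j | lift ord0 j \in I]%SET =
    [seq j <- enum 'I_(size w) | preim (lift ord0) (mem I) j].
  by rewrite enumT; apply: eq_filter => j; rewrite /= inE.
by case: ifP => _ /=; rewrite -map_comp;
  [congr cons|]; apply: eq_map => j /=; rewrite !(tnth_nth false).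
Qed.

Lemma occurrences_nil (w : word) : occurrences [::] w = 1%N.
Proof.
rewrite /occurrences (_ : [set _ | _]%SET = [set finset.set0]%SET) ?cards1//.
apply/setP => I; rewrite !inE -size_eq0 size_map -cardE.
by rewrite cards_eq0.
Qed.

Lemma occurrences_nilr (b : bool) (u : word) : occurrences (b :: u) [::] = 0%N.
Proof.
apply/eqP; rewrite cards_eq0; apply/eqP/setP => I; rewrite !inE.
by case: (enum I) => // -[].
Qed.

(** A set of positions in [a :: w] is a set of positions in [w], with or without
    the new first position; in the former case the first letters must agree. *)
Lemma occurrences_cons (a b : bool) (u w : word) :
  occurrences (b :: u) (a :: w) =
  ((a == b) * occurrences u w + occurrences (b :: u) w)%N.
Proof.
pose h (p : bool * {set 'I_(size w)}) : {set 'I_(size w).+1} :=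
  [set i | if unlift ord0 i is Some j then j \in p.2 else p.1]%SET.
pose h' (I : {set 'I_(size w).+1}) :=
  (ord0 \in I, [set j | lift ord0 j \in I]%SET).
have hK : cancel h h'.
  move=> [c J]; rewrite /h /h' /= inE unlift_none; congr pair.
  by apply/setP => j; rewrite !inE liftK.
have h'K : cancel h' h.
  move=> I; apply/setP => i; rewrite !inE; case: unliftP => [j|] -> //=.
  by rewrite inE.
rewrite {1}/occurrences -sum1dep_card /=.
rewrite (reindex h) /=; last by exists h' => ? _; [exact: hK|exact: h'K].
have -> : (\sum_(p | [seq tnth (in_tuple (a :: w)) i | i <- enum (h p)] == b :: u)
     1%N = \sum_(p : bool * {set 'I_(size w)})
     ((if p.1 then [:: a] else [::]) ++
      [seq tnth (in_tuple w) j | j <- enum p.2] == b :: u))%N.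
  rewrite big_mkcond /=; apply: eq_bigr => -[c J] _.
  rewrite map_enum_cons /=.
  have [-> ->] : (ord0 \in h (c, J)) = c /\
     [set j | lift ord0 j \in h (c, J)]%SET = J.
    by have := hK (c, J); rewrite /h' => -[-> ->].
  by case: (_ == _).
rewrite -(pair_bigA _ (fun c J => nat_of_bool ((if c then [:: a] else [::]) ++
      [seq tnth (in_tuple w) j | j <- enum (J : {set _})] == b :: u))%N) /=.
rewrite big_bool /= /occurrences -!sum1dep_card; congr addn.
  rewrite big_distrr /= [RHS]big_mkcond /=; apply: eq_bigr => J _.
  by rewrite eqseq_cons; case: (a == b); case: (_ == u).
by rewrite [RHS]big_mkcond /=; apply: eq_bigr => J _; case: (_ == _).
Qed.

(** * Counting occurrences from the prefix frequencies *)

Definition letter_cdf (R : realType) (F : R -> R) (b : bool) (x : R) : R :=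
  if b then F x else x - F x.

Definition prefix_freq (R : realType) (b : bool) (w : word) (i : nat) : R :=
  (count_mem b (take i w))%:R / (size w)%:R.

(** The prefix of length [i] corresponds to the interval from [0] to
    [i / size w], on which the limit function should have integral [F]. *)
Definition close_to_cdf (R : realType) (F : R -> R) (w : word) (e : R) :=
  forall i, (i <= size w)%N ->
    `|prefix_freq R true w i - F (i%:R / (size w)%:R)| <= e.

(** All that the counting argument needs to know about the iterated integrals
    [G u x] of [f^(u_1) (t_1) * .. * f^(u_l) (t_l)] over
    [x < t_1 < .. < t_l <= 1], when [F] is the primitive of [f]: passing from [u]
    to [b :: u] is an integration against the increments of [F] (or of the
    primitive [x - F x] of [1 - f]), and [G u] lies between its end values. *)
Record nested_tails (R : realType) (F : R -> R) (G : word -> R -> R) : Prop := {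
  nested_tails_nil : forall x, G [::] x = 1;
  nested_tails_end : forall b u, G (b :: u) 1 = 0;
  nested_tails_bound : forall u x, 0 <= G u x <= 1;
  nested_tails_step : forall b u x y, 0 <= x -> x <= y -> y <= 1 ->
    (letter_cdf F b y - letter_cdf F b x) * G u y
      <= G (b :: u) x - G (b :: u) y
      <= (letter_cdf F b y - letter_cdf F b x) * G u x }.

Definition slope_unit (R : realType) (F : R -> R) :=
  forall x y : R, 0 <= x -> x <= y -> y <= 1 -> 0 <= F y - F x <= y - x.

Lemma letter_cdf_slope (R : realType) (F : R -> R) b : slope_unit F ->
  slope_unit (letter_cdf F b).
Proof.
move=> HF x y x0 xy y1; have := HF x y x0 xy y1.
by rewrite /letter_cdf; case: b => //; lra.
Qed.

Lemma prefix_freq_letter (R : realType) (F : R -> R) (w : word) (e : R) b i :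
  (0 < size w)%N -> close_to_cdf F w e -> (i <= size w)%N ->
  `|prefix_freq R b w i - letter_cdf F b (i%:R / (size w)%:R)| <= e.
Proof.
move=> w0 H iw; have {}H := H i iw.
move: H; rewrite /letter_cdf /prefix_freq; case: b => // H.
have := count_predC (pred1 true) (take i w); rewrite size_takel//.
rewrite (@eq_count _ (predC _) (pred1 false)); last by case.
move=> /(congr1 (fun k => k%:R : R)); rewrite natrD => E.
have -> : (count_mem false (take i w))%:R = i%:R - (count_mem true (take i w))%:R :> R.
  by rewrite -E addrC addKr.
by rewrite -normrN; congr (`| _ | <= e): H; field; rewrite pnatr_eq0 -lt0n.
Qed.

Lemma prefix_freqS (R : realType) b (w : word) i : (i < size w)%N ->
  prefix_freq R b w i.+1 =
  prefix_freq R b w i + (nth false w i == b)%:R / (size w)%:R.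
Proof.
move=> iw; rewrite /prefix_freq (take_nth false iw) -cats1 count_cat /= addn0.
by rewrite natrD mulrDl.
Qed.

Lemma nested_tails_noninc (R : realType) (F : R -> R) G u x y :
  slope_unit F -> nested_tails F G -> 0 <= x -> x <= y -> y <= 1 ->
  G u y <= G u x.
Proof.
move=> HF HG x0 xy y1; case: u => [|b u]; first by rewrite !(nested_tails_nil HG).
have /andP[H _] := nested_tails_step HG b u x0 xy y1.
rewrite -subr_ge0 (le_trans _ H)// mulr_ge0//.
  by have /andP[] := letter_cdf_slope b HF x0 xy y1.
by have /andP[] := nested_tails_bound HG u y.
Qed.

(** The suffix of [w] starting at [j] satisfies a discrete version of the
    recursion for [G]. Prepending a letter to [u] adds three errors: the error
    already made for [u]; a term [2 e] from summation by parts, because the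
    prefix frequencies differ from [F] by at most [e] while [G u] decreases from
    at most [1] to at least [0]; and a term [1 / n] because [G u] is replaced by
    its value at an end point of each interval, which telescopes. *)
Lemma occurrences_tail_approx (R : realType) (F : R -> R) G (w : word) (e : R) :
  (0 < size w)%N -> slope_unit F -> nested_tails F G -> close_to_cdf F w e ->
  forall u j, (j <= size w)%N ->
  `|(occurrences u (drop j w))%:R / (size w)%:R ^+ size u
     - G u (j%:R / (size w)%:R)|
  <= (size u)%:R * (2 * e + (size w)%:R^-1).
Proof.
move=> w0 HF HG Hw; set n := size w.
have n0 : 0 < n%:R :> R by rewrite ltr0n.
elim => [|b u IHu] j jn.
  by rewrite occurrences_nil (nested_tails_nil HG) expr0 divr1 subrr normr0 mul0r.
set E := (size u)%:R * _ in IHu.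
pose x i : R := i%:R / n%:R.
have x0 i : 0 <= x i by rewrite /x divr_ge0.
have x1 i : (i <= n)%N -> x i <= 1.
  by move=> ?; rewrite /x ler_pdivrMr// mul1r ler_nat.
have xS i : x i <= x i.+1 by rewrite /x ler_pM2r ?invr_gt0// ler_nat.
have xSE i : x i.+1 - x i = n%:R^-1.
  by rewrite /x -mulrBl -natrB// subSnn mul1r.
pose a i := G u (x i).
pose D v i := (occurrences v (drop i w))%:R / n%:R ^+ size v : R.
pose P i := prefix_freq R b w i - letter_cdf F b (x i).
pose Z i := D (b :: u) i - G (b :: u) (x i) + P i * a i.
(* The boundary term [P i * a i] is what makes the differences of [Z] small:
   in them [P] only occurs multiplied by [a i - a i.+1]. *)
have HZ i : (i <= n)%N ->
    `|Z i| <= (e + n%:R^-1) * a i + (n%:R - i%:R) / n%:R * E.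
  move=> iN; rewrite -(subKn iN); move: (leq_subr i n); rewrite -/n.
  elim: (n - i)%N => [|k IHk] kn.
    rewrite subn0 subrr mul0r mul0r addr0 /Z /D /a drop_size occurrences_nilr.
    have -> : x n = 1 by rewrite /x divff// gt_eqF.
    rewrite mul0r (nested_tails_end HG) subrr add0r normrM.
    have /andP[a0 a1] := nested_tails_bound HG u 1.
    rewrite (ger0_norm a0) ler_wpM2r//.
    have HP : `|P n| <= e by exact: prefix_freq_letter (leqnn n).
    by rewrite (le_trans HP)// lerDl invr_ge0 ler0n.
  have {IHk} := IHk (ltnW kn).
  have -> : (n - k = (n - k.+1).+1)%N by lia.
  set i' := (n - k.+1)%N; have i'n : (i' < n)%N by rewrite /i'; lia.
  move: i' i'n => {k kn} {}i {}iN IH.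
  set p : R := (nth false w i == b)%:R / n%:R.
  have p0 : 0 <= p <= n%:R^-1.
    rewrite /p; case: (_ == _); rewrite ?mul0r ?mul1r ?lexx ?invr_ge0 ?ler0n//.
  have PS : P i.+1 = P i + p - (letter_cdf F b (x i.+1) - letter_cdf F b (x i)).
    by rewrite /P prefix_freqS// -/p; ring.
  set q := letter_cdf F b (x i.+1) - letter_cdf F b (x i) in PS.
  have DS : D (b :: u) i = p * D u i.+1 + D (b :: u) i.+1.
    rewrite /D (drop_nth false iN) occurrences_cons natrD natrM mulrDl /p.
    by rewrite /= exprS; field; rewrite expf_neq0 ?gt_eqF// gt_eqF.
  have Hstep := nested_tails_step HG b u (x0 i) (xS i) (x1 _ iN).
  rewrite -/q in Hstep; rewrite -/(a i.+1) -/(a i) in Hstep.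
  have aS : a i.+1 <= a i := nested_tails_noninc u HF HG (x0 i) (xS i) (x1 _ iN).
  have HP : `|P i| <= e by exact: prefix_freq_letter (ltnW iN).
  have Hq := letter_cdf_slope b HF (x0 i) (xS i) (x1 _ iN).
  rewrite -/q xSE in Hq.
  have HD : `|D u i.+1 - a i.+1| <= E by exact: IHu.
  set rho := G (b :: u) (x i) - G (b :: u) (x i.+1) - q * a i.+1.
  have ZE : Z i = Z i.+1 + (p * (D u i.+1 - a i.+1) - rho + P i * (a i - a i.+1)).
    by rewrite /Z DS PS /rho; ring.
  have H1 : `|p * (D u i.+1 - a i.+1)| <= n%:R^-1 * E.
    case/andP: p0 => p0 p1.
    by rewrite normrM (ger0_norm p0) ler_pM.
  have H2 : `|rho| <= n%:R^-1 * (a i - a i.+1).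
    have q1 : q * (a i - a i.+1) <= n%:R^-1 * (a i - a i.+1).
      by rewrite ler_wpM2r ?subr_ge0//; case/andP: Hq.
    by rewrite ger0_norm /rho; lra.
  have H3 : `|P i * (a i - a i.+1)| <= e * (a i - a i.+1).
    by rewrite normrM [X in _ * X]ger0_norm ?subr_ge0// ler_wpM2r ?subr_ge0.
  have -> : (n%:R - i%:R) / n%:R * E = (n%:R - i.+1%:R) / n%:R * E + n%:R^-1 * E.
    by rewrite -natr1; field; rewrite gt_eqF.
  rewrite ZE.
  have := ler_normD (Z i.+1) (p * (D u i.+1 - a i.+1) - rho + P i * (a i - a i.+1)).
  have := ler_normD (p * (D u i.+1 - a i.+1) - rho) (P i * (a i - a i.+1)).
  have := ler_normB (p * (D u i.+1 - a i.+1)) rho.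
  by lra.
have HP : `|P j| <= e by exact: prefix_freq_letter jn.
have HZj := HZ j jn.
have /andP[a0 a1] := nested_tails_bound HG u (x j).
have E0 : 0 <= E by exact: le_trans (normr_ge0 _) (IHu _ jn).
have H1 : (n%:R - j%:R) / n%:R * E <= E.
  rewrite ler_piMl// ler_pdivrMr// mul1r gerBl//.
have e0 : 0 <= e by exact: le_trans HP.
have n0' : 0 <= n%:R^-1 :> R by rewrite invr_ge0 ltW.
have H2 : (e + n%:R^-1) * a j <= e + n%:R^-1 by rewrite ler_piMr// addr_ge0.
have H3 : `|P j * a j| <= e.
  by rewrite normrM (ger0_norm a0) (le_trans _ HP)// ler_piMr.
rewrite [X in `|X|](_ : _ = Z j - P j * a j); last by rewrite /Z /D /x; ring.
have := ler_normB (Z j) (P j * a j).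
have -> : (size (b :: u))%:R * (2 * e + n%:R^-1) = E + (2 * e + n%:R^-1).
  by rewrite /E /= -natr1; ring.
by lra.
Qed.

Lemma cvg_near_eq (R : realType) (I : Type) (D : set_system I) (f g : I -> R)
    (l : R) {FF : Filter D} :
  (\forall i \near D, f i = g i) -> f @ D --> l -> g @ D --> l.
Proof. by move=> fg; apply: cvg_trans; exact: near_eq_cvg. Qed.

Lemma cvg_natr_inv (R : realType) (I : Type) (D : set_system I) (k : I -> nat)
    {FF : Filter D} :
  k @ D --> \oo -> (k i)%:R^-1 @[i --> D] --> (0 : R).
Proof.
move=> kD; apply: (cvg_comp k (fun n => n%:R^-1 : R) kD).
apply/cvgrPdist_lt => _/posnumP[e].
have [N _ HN] := near_infty_natSinv_lt e.
exists N.+1 => // -[//|n] /= Nn.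
by rewrite sub0r normrN ger0_norm ?invr_ge0//; exact: HN.
Qed.

(** Dividing by ['C(n, l)] instead of [n ^ l] only costs the factor [l!] in the
    limit. *)
Lemma cvg_expn_binomial (R : realType) (l : nat) :
  (n%:R ^+ l / 'C(n, l)%:R) @[n --> \oo] --> (l`!%:R : R).
Proof.
suff H : ((n ^_ l)%:R / n%:R ^+ l) @[n --> \oo] --> (1 : R).
  rewrite -[X in _ --> X]mulr1 -[X in _ * X]invr1.
  apply: (cvg_near_eq _ (cvgM (cvg_cst _) (cvgV (oner_neq0 R) H))); near=> n.
  have ln : (l <= n)%N by near: n; exact: nbhs_infty_ge.
  have n0 : (0 < n)%N by near: n; exact: nbhs_infty_gt.
  rewrite /= -bin_ffact natrM; field.
  by rewrite expf_neq0 ?pnatr_eq0 -?lt0n// bin_gt0 fact_gt0 ln.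
elim: l => [|l IHl].
  by under eq_fun do rewrite ffactn0 expr0 divr1; exact: cvg_cst.
have H : (1 - l%:R * n%:R^-1) @[n --> \oo] --> (1 : R).
  rewrite -[X in _ --> X]subr0; apply: cvgB; first exact: cvg_cst.
  rewrite -[X in _ --> X](mulr0 (l%:R)).
  by apply: cvgM; [exact: cvg_cst|apply: cvg_natr_inv; exact: cvg_id].
rewrite -[X in _ --> X]mulr1; apply: (cvg_near_eq _ (cvgM IHl H)); near=> n.
have ln : (l <= n)%N by near: n; exact: nbhs_infty_ge.
have n0 : (0 < n)%N by near: n; exact: nbhs_infty_gt.
rewrite ffactnSr natrM natrB// exprSr /=; field.
by rewrite expf_neq0 ?andbT pnatr_eq0 -lt0n.
Unshelve. all: by end_near. Qed.

Lemma word_sequence_ge (w : nat -> word) N : word_sequence w ->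
  \forall n \near \oo, (N <= size (w n))%N.
Proof. by move=> Hw; exact: (Hw _ (nbhs_infty_ge N)). Qed.

Lemma word_density_cvg (R : realType) (F : R -> R) G (w : nat -> word) :
  slope_unit F -> nested_tails F G -> word_sequence w ->
  (forall e, 0 < e -> \forall n \near \oo, close_to_cdf F (w n) e) ->
  forall u, word_density R u (w n) @[n --> \oo] --> (size u)`!%:R * G u 0.
Proof.
move=> HF HG Hw Hc u; set l := size u.
pose A n : R := (occurrences u (w n))%:R / (size (w n))%:R ^+ l.
have HA : A @ \oo --> G u 0.
  apply/cvgrPdist_le => e e0; pose e' := e / (l%:R + 1) / 3.
  have l0 : 0 < l%:R + 1 :> R by rewrite ltr_wpDl.
  have e'0 : 0 < e' by rewrite !divr_gt0.
  have He' : \forall n \near \oo, (size (w n))%:R^-1 <= e'.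
    have /cvgrPdist_le : (size (w m))%:R^-1 @[m --> \oo] --> (0 : R).
      exact: cvg_natr_inv Hw.
    move=> /(_ _ e'0); apply: filterS => m.
    by rewrite sub0r normrN ger0_norm ?invr_ge0.
  near=> n; have n0 : (0 < size (w n))%N by near: n; exact: word_sequence_ge.
  have H1 : close_to_cdf F (w n) e' by near: n; exact: Hc.
  have := occurrences_tail_approx n0 HF HG H1 u (leq0n _).
  rewrite drop0 mul0r distrC => /le_trans; apply.
  have H2 : (size (w n))%:R^-1 <= e' by near: n.
  rewrite -/l (@le_trans _ _ ((l%:R + 1) * (3 * e')))//.
    have n1 : 0 <= (size (w n))%:R^-1 :> R by rewrite invr_ge0.
    by apply: ler_pM => //; lra.
  by rewrite /e' le_eqVlt; apply/orP; left; apply/eqP; field; rewrite gt_eqF.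
have HC : ((size (w n))%:R ^+ l / 'C(size (w n), l)%:R) @[n --> \oo]
    --> (l`!%:R : R).
  exact: cvg_comp Hw (@cvg_expn_binomial R l).
apply: (cvg_near_eq _ (cvgM HC HA)); near=> n.
have n0 : (0 < size (w n))%N by near: n; exact: word_sequence_ge.
have nl : (l <= size (w n))%N by near: n; exact: word_sequence_ge.
rewrite /A /word_density /= -/l; field.
by rewrite expf_neq0 ?pnatr_eq0 -?lt0n ?bin_gt0 ?nl.
Unshelve. all: by end_near. Qed.

(** * Distribution functions of words *)

Lemma prefix_freq_slope (R : realType) b (w : word) (i j : nat) : (i <= j)%N ->
  0 <= prefix_freq R b w j - prefix_freq R b w i <= (j%:R - i%:R) / (size w)%:R.
Proof.
move=> ij; rewrite /prefix_freq -mulrBl.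
have -> : take j w = take i w ++ take (j - i) (drop i w).
  by rewrite -[in LHS](subnKC ij) takeD.
rewrite count_cat natrD addrAC subrr add0r divr_ge0//= ler_wpM2r ?invr_ge0//.
rewrite -natrB// ler_nat (leq_trans (count_size _ _))// size_take_min geq_minl//.
Qed.

(** The empirical distribution function of the positions of the letter 1. *)
Definition word_cdf (R : realType) (w : word) (x : R) : R :=
  prefix_freq R true w (Num.truncn (x * (size w)%:R)).

Lemma word_cdf_slope (R : realType) (w : word) (x y : R) :
  (0 < size w)%N -> 0 <= x -> x <= y ->
  0 <= word_cdf w y - word_cdf w x <= y - x + (size w)%:R^-1.
Proof.
move=> w0 x0 xy; have n0 : 0 < (size w)%:R :> R by rewrite ltr0n.
have xyn : x * (size w)%:R <= y * (size w)%:R by rewrite ler_pM2r.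
have /andP[-> H] /= := prefix_freq_slope R true w (le_truncn xyn).
rewrite (le_trans H)// ler_pdivrMr// mulrDl mulVf ?gt_eqF// mulrBl.
have /andP[_] : _ <= x * (size w)%:R < _ := truncn_itv (mulr_ge0 x0 (ltW n0)).
have y0 := le_trans x0 xy.
have /andP[+ _] : _ <= y * (size w)%:R < _ := truncn_itv (mulr_ge0 y0 (ltW n0)).
by rewrite -natr1; lra.
Qed.

(** The slopes of both distribution functions are at most one (up to [1 / n] for
    words), so it suffices to compare them on a fine grid. *)
Lemma close_to_cdf_pointwise (R : realType) (F : R -> R) (w : nat -> word) :
  slope_unit F -> word_sequence w ->
  (forall x, 0 <= x <= 1 -> word_cdf (w n) x @[n --> \oo] --> F x) ->
  forall e, 0 < e -> \forall n \near \oo, close_to_cdf F (w n) e.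
Proof.
move=> HF Hw H e e0; pose K := (Num.truncn (4 / e)).+1.
have K0 : 0 < K%:R :> R by rewrite ltr0n.
have Ke : K%:R^-1 <= e / 4.
  by rewrite invf_ple ?posrE ?divr_gt0// invf_div ltW// truncnS_gt.
have grid : \forall n \near \oo, forall k : 'I_K.+1,
    `|word_cdf (w n) (k%:R / K%:R) - F (k%:R / K%:R)| <= e / 4.
  apply: filter_forall => k.
  have k01 : 0 <= (k%:R / K%:R : R) <= 1.
    by apply/andP; split; [rewrite divr_ge0|rewrite ler_pdivrMr// mul1r ler_nat -ltnS].
  have e4 : 0 < e / 4 by rewrite divr_gt0.
  have /cvgrPdist_le/(_ _ e4) := H _ k01.
  by apply: filterS => n; rewrite distrC.
have He : \forall n \near \oo, (size (w n))%:R^-1 <= e / 4.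
  have /cvgrPdist_le : (size (w m))%:R^-1 @[m --> \oo] --> (0 : R).
    exact: cvg_natr_inv Hw.
  have e4 : 0 < e / 4 by rewrite divr_gt0.
  by move=> /(_ _ e4); apply: filterS => n; rewrite sub0r normrN ger0_norm ?invr_ge0.
near=> n => i iw.
have n0 : (0 < size (w n))%N by near: n; exact: word_sequence_ge.
set x := i%:R / _.
have x01 : 0 <= x <= 1.
  by rewrite divr_ge0//= ler_pdivrMr ?ltr0n// mul1r ler_nat.
case/andP: (x01) => x0 x1.
pose k := Num.truncn (x * K%:R).
have xK0 : 0 <= x * K%:R by rewrite mulr_ge0// ltW.
have /andP[k1 k2] : k%:R <= x * K%:R < k.+1%:R := truncn_itv xK0.
have kK : (k < K.+1)%N.
  by rewrite ltnS -(ler_nat R) (le_trans k1)// ler_piMl// ltW.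
pose y : R := k%:R / K%:R.
have y0 : 0 <= y by rewrite divr_ge0.
have yx : y <= x by rewrite ler_pdivrMr.
have xy : x - y <= e / 4.
  rewrite (le_trans _ Ke)// lerBlDr /y -[X in _ <= X + _]mul1r -mulrDl.
  by rewrite ler_pdivlMr// addrC natr1 ltW.
have /andP[F1 F2] := HF _ _ y0 yx x1.
have /andP[] := word_cdf_slope n0 y0 yx.
have -> : word_cdf (w n) x = prefix_freq R true (w n) i.
  by rewrite /word_cdf /x divfK ?natrK// pnatr_eq0 -lt0n.
have : (size (w n))%:R^-1 <= e / 4 by near: n.
have : `|word_cdf (w n) y - F y| <= e / 4.
  suff gridn : forall k : 'I_K.+1,
      `|word_cdf (w n) (k%:R / K%:R) - F (k%:R / K%:R)| <= e / 4.
    exact: gridn (Ordinal kK).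
  by near: n.
by rewrite !ler_norml; lra.
Unshelve. all: by end_near. Qed.

(** When [a] increases by at most [1] at each step, its integer part increases by
    [0] or [1], so counting its increases recovers it. *)
Lemma count_rounded (R : realType) (a : nat -> R) (n i : nat) :
  a 0%N = 0 -> (forall i, (i <= n)%N -> 0 <= a i) -> 
  (forall i, (i < n)%N -> a i <= a i.+1 <= a i + 1) ->
  (i <= n)%N ->
  count_mem true (take i (mkseq
    (fun i => Num.truncn (a i) < Num.truncn (a i.+1))%N n)) = Num.truncn (a i).
Proof.
move=> a0 age aS; elim: i => [|i IHi] iN; first by rewrite take0 a0 truncn0.
rewrite (take_nth false) ?size_mkseq// -cats1 count_cat IHi ?(ltnW iN)//=.
rewrite nth_mkseq// addn0; have /andP[/le_truncn H1 H2] := aS _ iN.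
have : (Num.truncn (a i.+1) <= (Num.truncn (a i)).+1)%N.
  have := le_truncn H2; rewrite -[1]/(1%:R) => H3.
  rewrite (leq_trans H3)// truncn_le_nat.
  have /andP[_] := truncn_itv (age i (ltnW iN)).
  by rewrite -[X in _ < X]natr1; lra.
by move: H1; rewrite leq_eqVlt; case: ltngtP => //=; lia.
Qed.

(** A word of length [n] whose prefix of length [i] contains the integer part of
    [n F(i / n)] letters 1. *)
Definition rounded_word (R : realType) (F : R -> R) (n : nat) : word :=
  mkseq (fun i => (Num.truncn (n%:R * F (i%:R / n%:R)) <
                   Num.truncn (n%:R * F (i.+1%:R / n%:R)))%N) n.

Lemma rounded_word_close (R : realType) (F : R -> R) (n : nat) :
  (0 < n)%N -> F 0 = 0 -> slope_unit F ->
  close_to_cdf F (rounded_word F n) n%:R^-1.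
Proof.
move=> n0 F0 HF i; rewrite /rounded_word size_mkseq => iN.
have n0' : 0 < n%:R :> R by rewrite ltr0n.
pose a i := n%:R * F (i%:R / n%:R) : R.
have x0 k : 0 <= k%:R / n%:R :> R by rewrite divr_ge0.
have x1 k : (k <= n)%N -> k%:R / n%:R <= 1 :> R.
  by move=> kn; rewrite ler_pdivrMr// mul1r ler_nat.
have age k : (k <= n)%N -> 0 <= a k.
  move=> kn; have /andP[+ _] := HF _ _ (lexx 0) (x0 k) (x1 _ kn).
  by rewrite F0 subr0 => H; rewrite mulr_ge0// ltW.
have aS k : (k < n)%N -> a k <= a k.+1 <= a k + 1.
  move=> kn; have xS : k%:R / n%:R <= k.+1%:R / n%:R :> R.
    by rewrite ler_pM2r ?invr_gt0// ler_nat.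
  have := HF _ _ (x0 k) xS (x1 _ kn).
  rewrite -mulrBl -natrB// subSnn mul1r => /andP[H1 H2].
  rewrite /a ler_pM2l// -subr_ge0 H1/= -lerBlDl -mulrBr.
  by rewrite -(@ler_pM2l _ n%:R^-1) ?invr_gt0// mulrA mulVf ?gt_eqF// mul1r mulr1.
have a0 : a 0%N = 0 by rewrite /a mul0r F0 mulr0.
rewrite /prefix_freq size_mkseq (count_rounded a0 age aS iN).
have /andP[t1 t2] := truncn_itv (age _ iN).
have -> : F (i%:R / n%:R) = a i / n%:R by rewrite /a mulrAC divff ?mul1r ?gt_eqF.
rewrite -mulrBl normrM [X in _ * X]ger0_norm ?invr_ge0//.
rewrite ler_piMl ?invr_ge0// ler_norml; move: t2; rewrite -natr1; lra.
Qed.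

(** * Recovering the distribution function from the densities *)

Fixpoint words (k : nat) : seq word :=
  if k is k'.+1 then map (cons true) (words k') ++ map (cons false) (words k')
  else [:: [::]].

Lemma size_words k u : u \in words k -> size u = k.
Proof.
elim: k u => [|k IHk] u; first by rewrite inE => /eqP ->.
by rewrite mem_cat => /orP[] /mapP[v /IHk <- ->].
Qed.

Lemma sum_words_occurrences k w :
  (\sum_(u <- words k) occurrences u w = 'C(size w, k))%N.
Proof.
elim: w k => [|a w IHw] [|k]; rewrite ?big_seq1 ?occurrences_nil ?bin0//=.
  by rewrite big_cat !big_map/= !big1// => u _; rewrite occurrences_nilr.
rewrite binS -!IHw [in RHS]/= !big_cat !big_map/= addnC.
under eq_bigr do rewrite occurrences_cons.
under [X in (_ + X)%N]eq_bigr do rewrite occurrences_cons.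
rewrite !big_split -!big_distrr /=.
by case: a => /=; rewrite ?mul1n ?mul0n ?add0n; ring.
Qed.

(** Sampling a word with first letter 1 amounts to choosing the position of that
    letter, and then any positions after it. *)
Lemma sum_words_occurrences1 k w :
  (\sum_(u <- words k) occurrences (true :: u) w =
   \sum_(i < size w) nth false w i * 'C((size w).-1 - i, k))%N.
Proof.
elim: w => [|a w IHw].
  by rewrite big_ord0 big1// => u _; rewrite occurrences_nilr.
rewrite big_ord_recl /= subn0 -sum_words_occurrences big_distrr/=.
under eq_bigr do rewrite occurrences_cons.
rewrite big_split/= IHw; congr addn; first by case: a.
by apply: eq_bigr => -[i /= iw] _; rewrite /bump/= add1n subnS predn_sub.
Qed.

Lemma bernoulli_le (R : realType) (z : R) b : 0 <= z <= 1 ->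
  1 - b%:R * z <= (1 - z) ^+ b /\ (1 - z) ^+ b * (1 + b%:R * z) <= 1.
Proof.
move=> /andP[z0 z1]; elim: b => [|b [IH1 IH2]].
  by rewrite expr0 mul0r subr0 addr0 mul1r lexx.
have p0 : 0 <= (1 - z) ^+ b by rewrite exprn_ge0 // subr_ge0.
have bz : 0 <= b%:R * z by rewrite mulr_ge0.
rewrite exprS -natr1; split.
  have := ler_wpM2l (_ : 0 <= 1 - z) IH1; rewrite subr_ge0 => /(_ z1).
  have : 0 <= b%:R * z * z by rewrite mulr_ge0.
  by lra.
have : 0 <= (1 - z) ^+ b * (z * z * (b%:R + 1)).
  by rewrite !mulr_ge0 ?addr_ge0.
by nra.
Qed.

(** Polynomials approximating the indicator function of [[theta, 1]]. Writing
    [z = y ^ a] and choosing [b] close to [theta ^- a], the number [b z] is very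
    small for [y] below [theta] and very large above, and [1 - (1 - z) ^ b] is at
    most [b z] and at least [1 - 1 / (1 + b z)]. *)
Lemma step_poly (R : realType) (theta eta eps : R) :
  0 <= theta -> 0 < eta -> 0 < eps ->
  exists P : {poly R}, forall y, 0 <= y <= 1 ->
    [/\ 0 <= P.[y] <= 1, theta + eta <= y -> 1 - eps <= P.[y] &
        y <= theta - eta -> P.[y] <= eps].
Proof.
rewrite le_eqVlt => /predU1P[<-|th0] eta0 eps0.
  exists 1 => y /andP[y0 y1]; rewrite hornerC; split; [by rewrite ler01 lexx|..].
    by move=> _; lra.
  by move=> H; exfalso; lra.
pose r := theta / (theta + eta).
have the0 : 0 < theta + eta by rewrite addr_gt0.
have r0 : 0 <= r by rewrite divr_ge0// ltW.
have r1 : r < 1 by rewrite ltr_pdivrMr// mul1r ltrDl.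
have [a ra] : exists a, r ^+ a <= eps.
  have /cvgrPdist_le/(_ _ eps0) : r ^+ n @[n --> \oo] --> (0 : R).
    by apply: cvg_expr; rewrite ger0_norm.
  case=> N _ /(_ N (leqnn N)) /=.
  by rewrite sub0r normrN ger0_norm ?exprn_ge0// => H; exists N.
pose b := Num.truncn (theta ^- a).
have tha : 0 < theta ^+ a by rewrite exprn_gt0.
have /andP[b1 b2] : b%:R <= theta ^- a < b.+1%:R.
  by apply: truncn_itv; rewrite invr_ge0 ltW.
exists (1 - (1 - 'X^a) ^+ b) => y /andP[y0 y1].
rewrite !(hornerE, horner_exp)/=.
set z := y ^+ a.
have z01 : 0 <= z <= 1 by rewrite exprn_ge0//= exprn_ile1.
have [B1 B2] := bernoulli_le b z01; case/andP: z01 => z0 z1.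
have p0 : 0 <= (1 - z) ^+ b by rewrite exprn_ge0// subr_ge0.
have p1 : (1 - z) ^+ b <= 1 by rewrite exprn_ile1// ?subr_ge0//; lra.
split; [lra|move=> yt|move=> yt].
  have za : (theta + eta) ^+ a <= z by apply: lerXn2r; rewrite ?nnegrE// ltW.
  rewrite lerD2l lerN2 (le_trans _ ra)//.
  rewrite /r expr_div_n ler_pdivlMr ?exprn_gt0//.
  rewrite -[leRHS]mul1r -ler_pdivrMr// -mulrA (le_trans _ B2)// ler_wpM2l//.
  rewrite ler_pdivrMr// (le_trans za)//.
  have : 1 <= (b%:R + 1) * theta ^+ a.
    by rewrite -ler_pdivrMr// mul1r natr1 ltW.
  by have := mulr_ge0 (ler0n R b) z0; nra.
have yr : y / theta <= r.
  rewrite /r ler_pdivrMr// mulrAC ler_pdivlMr//; nra.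
rewrite (le_trans _ ra)//.
have : b%:R * z <= r ^+ a.
  rewrite (@le_trans _ _ ((y / theta) ^+ a))//.
    by rewrite expr_div_n mulrC ler_wpM2l.
  by apply: lerXn2r; rewrite ?nnegrE// divr_ge0// ltW.
by lra.
Qed.

Definition poly_moment (R : realType) (P : {poly R}) (w : word) : R :=
  (\sum_(i < size w) (nth false w i)%:R * P.[1 - i%:R / (size w)%:R])
    / (size w)%:R.

Lemma weighted_sum_le (R : realType) (w : word) (x y : nat -> R) :
  `|\sum_(i < size w) (nth false w i)%:R * x i
    - \sum_(i < size w) (nth false w i)%:R * y i|
  <= \sum_(i < size w) `|x i - y i|.
Proof.
rewrite -sumrB (le_trans (ler_norm_sum _ _ _))// ler_sum// => i _.
by rewrite -mulrBr normrM; case: nth; rewrite ?normr1 ?mul1r ?normr0 ?mul0r.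
Qed.

(** The [j]-th of the [k] factors of the ratio of binomial coefficients is
    [(m - j) / (n - 1 - j)], which differs from [(m + 1) / n] by at most
    [(j + 1) / (n - 1 - j)], uniformly in [m]. *)
Lemma bin_ratio_cvg (R : realType) k (e : R) : 0 < e ->
  \forall n \near \oo, forall m, (m < n)%N ->
    `|'C(m, k)%:R / 'C(n.-1, k)%:R - (m.+1%:R / n%:R) ^+ k| <= e.
Proof.
elim: k e => [|k IHk] e e0.
  near=> n => m mn.
  by rewrite !bin0 divff// expr0 subrr normr0 ltW.
have e20 : 0 < e / 2 by rewrite divr_gt0.
near=> n => m mn.
have IH : forall m, (m < n)%N ->
    `|'C(m, k)%:R / 'C(n.-1, k)%:R - (m.+1%:R / n%:R) ^+ k| <= e / 2.
  by near: n; exact: IHk.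
have {}IH := IH m mn.
have kn : (k.+1 < n)%N by near: n; exact: nbhs_infty_gt.
have ke : k.+1%:R / (n.-1 - k)%:R <= e / 2.
  pose N := (Num.truncn (k.+1%:R / (e / 2))).+1.
  have NE : k.+1%:R / (e / 2) < N%:R by exact: truncnS_gt.
  have nN : (N + k.+1 <= n)%N by near: n; exact: nbhs_infty_ge.
  rewrite ler_pdivrMr ?ltr0n; last by lia.
  rewrite mulrC -ler_pdivrMr// (le_trans (ltW NE))// ler_nat; lia.
set y := m.+1%:R / n%:R in IH *.
pose b : R := (m - k)%:R / (n.-1 - k)%:R.
have nk0 : 0 < (n.-1 - k)%:R :> R by rewrite ltr0n; lia.
have n0 : 0 < n%:R :> R by rewrite ltr0n; lia.
have b0 : 0 <= b by rewrite divr_ge0.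
have y01 : 0 <= y <= 1.
  by rewrite divr_ge0//= ler_pdivrMr// mul1r ler_nat.
have by_ : 0 <= y - b <= k.+1%:R / (n.-1 - k)%:R.
  rewrite /y /b; have [km|mk] := leqP k m; last first.
    rewrite (eqP (ltnW mk : (m - k)%N == 0%N)) mul0r subr0.
    case/andP: y01 => -> _ /=.
    apply: ler_pM; rewrite ?invr_ge0 ?ler0n// ?ler_nat; first lia.
    by rewrite lef_pV2 ?posrE// ler_nat; lia.
  have -> : m.+1%:R / n%:R - (m - k)%:R / (n.-1 - k)%:R =
      (k.+1%:R / (n.-1 - k)%:R) * ((n.-1 - m)%:R / n%:R) :> R.
    have n1 : (0 < n)%N by exact: leq_ltn_trans kn.
    have nE : n%:R = (n.-1)%:R + 1 :> R by rewrite natr1 prednK.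
    move: nk0 n0; rewrite !natrB//; [|lia..] => nk0 n0.
    rewrite nE -!natr1; field; rewrite -nE; lra.
  have c0 : 0 <= k.+1%:R / (n.-1 - k)%:R :> R by rewrite divr_ge0.
  rewrite mulr_ge0 ?divr_ge0//= ler_piMr// ler_pdivrMr// mul1r ler_nat.
  by rewrite (leq_trans (leq_subr _ _)) ?leq_pred.
have -> : 'C(m, k.+1)%:R / 'C(n.-1, k.+1)%:R = 'C(m, k)%:R / 'C(n.-1, k)%:R * b.
  have C0 : (0 < 'C(n.-1, k))%N by rewrite bin_gt0 -ltnS (ltn_predK kn) ltnW.
  have C1 : (0 < 'C(n.-1, k.+1))%N by rewrite bin_gt0 -ltnS (ltn_predK kn).
  have E j : k.+1%:R * 'C(j, k.+1)%:R = (j - k)%:R * 'C(j, k)%:R :> R.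
    by rewrite -!natrM mul_bin_left.
  apply: (@mulfI _ (k.+1%:R * 'C(n.-1, k.+1)%:R)).
    by rewrite mulf_neq0 ?pnatr_eq0 -?lt0n.
  rewrite {2}(E n.-1) /b.
  rewrite [LHS](_ : _ = k.+1%:R * 'C(m, k.+1)%:R); last first.
    by field; rewrite pnatr_eq0 -lt0n.
  rewrite E; field.
  by rewrite gt_eqF//= pnatr_eq0 -lt0n.
set c := _ / _ in IH *.
have b1 : b <= 1 by lra.
have yk : 0 <= y ^+ k <= 1.
  by case/andP: y01 => y0 y1; rewrite exprn_ge0//= exprn_ile1.
rewrite exprSr (_ : c * b - y ^+ k * y = (c - y ^+ k) * b - y ^+ k * (y - b)); last first.
  by ring.
have := ler_normB ((c - y ^+ k) * b) (y ^+ k * (y - b)).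
have : `|(c - y ^+ k) * b| <= e / 2.
  by rewrite normrM (ger0_norm b0) (le_trans _ IH)// ler_piMr.
have : `|y ^+ k * (y - b)| <= e / 2.
  case/andP: by_ => h1 h2; case/andP: yk => h3 h4.
  rewrite ger0_norm ?mulr_ge0// (le_trans _ ke)// (le_trans _ h2)//.
  by rewrite ler_piMl.
lra.
Unshelve. all: by end_near. Qed.

Section determination.
Variables (R : realType) (I : Type) (D : set_system I).
Context {FD : Filter D}.
Local Notation Xn k := ('X^k : {poly R}).

Definition first_one_density k w : R :=
  \sum_(u <- words k) word_density R (true :: u) w.

(** This sum of densities is a moment in which the power [(1 - i / n) ^ k] is
    replaced by a ratio of binomial coefficients. *)
Lemma first_one_densityE k w : (0 < size w)%N ->
  first_one_density k w = k.+1%:R *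
    ((\sum_(i < size w) (nth false w i)%:R *
      ('C((size w).-1 - i, k)%:R / 'C((size w).-1, k)%:R)) / (size w)%:R).
Proof.
move=> w0; rewrite /first_one_density.
transitivity ((\sum_(u <- words k) occurrences (true :: u) w)%:R
    / 'C(size w, k.+1)%:R : R).
  rewrite natr_sum mulr_suml big_seq_cond [RHS]big_seq_cond.
  apply: eq_bigr => u /andP[/size_words uk _].
  by rewrite /word_density /= uk.
rewrite sum_words_occurrences1 natr_sum !mulr_suml mulr_sumr.
apply: eq_bigr => i _; rewrite natrM.
have := mul_bin_diag (size w) k => /(congr1 (fun n => n%:R : R)).
rewrite !natrM => E.
have w0' : (size w)%:R != 0 :> R by rewrite pnatr_eq0 -lt0n.
have -> : 'C(size w, k.+1)%:R = (size w)%:R * 'C((size w).-1, k)%:R / k.+1%:R :> R.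
  by rewrite E mulrC mulKf ?pnatr_eq0.
have [kw|kw] := leqP k (size w).-1; last first.
  rewrite (@bin_small ((size w).-1 - i)) ?(leq_ltn_trans (leq_subr _ _))//.
  by rewrite !(mul0r, mulr0).
by field; rewrite w0' !pnatr_eq0 -lt0n bin_gt0 kw nat1r pnatr_eq0.
Qed.

Lemma moment_first_one_density (v : I -> word) k :
  (fun i => size (v i)) @ D --> \oo ->
  poly_moment (Xn k) (v i) - k.+1%:R^-1 * first_one_density k (v i)
    @[i --> D] --> (0 : R).
Proof.
move=> Dv; apply/cvgrPdist_le => e e0.
have : \forall i \near D, forall m, (m < size (v i))%N ->
    `|'C(m, k)%:R / 'C((size (v i)).-1, k)%:R - (m.+1%:R / (size (v i))%:R) ^+ k| <= e.
  exact: (Dv _ (bin_ratio_cvg k e0)).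
have : \forall i \near D, (0 < size (v i))%N by exact: (Dv _ (nbhs_infty_gt 0)).
apply: filterS2 => i n0 H; rewrite sub0r normrN.
have n0' : 0 < (size (v i))%:R :> R by rewrite ltr0n.
rewrite first_one_densityE// mulKf ?pnatr_eq0// /poly_moment -mulrBl normrM.
rewrite [X in _ * X]ger0_norm ?invr_ge0// ler_pdivrMr//.
rewrite (le_trans (weighted_sum_le _
  (fun j => (Xn k).[1 - j%:R / (size (v i))%:R])
  (fun j => 'C((size (v i)).-1 - j, k)%:R / 'C((size (v i)).-1, k)%:R)))//.
have -> : e * (size (v i))%:R = \sum_(j < size (v i)) e.
  by rewrite sumr_const card_ord mulr_natr.
apply: ler_sum => j _.
have jn : ((size (v i)).-1 - j < size (v i))%N.
  by rewrite (leq_ltn_trans (leq_subr _ _))// ltn_predL.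
have -> : 1 - j%:R / (size (v i))%:R =
    ((size (v i)).-1 - j).+1%:R / (size (v i))%:R :> R.
  have -> : ((size (v i)).-1 - j).+1 = (size (v i) - j)%N.
    by rewrite -predn_sub prednK// subn_gt0.
  by rewrite natrB 1?ltnW// mulrBl divff ?gt_eqF.
by rewrite !hornerE distrC; exact: H.
Qed.

Lemma cvg_sum0 (g : nat -> I -> R) n :
  (forall k, g k i @[i --> D] --> (0 : R)) ->
  \sum_(k < n) g k i @[i --> D] --> (0 : R).
Proof.
move=> H; elim: n => [|n IHn].
  by under eq_fun do rewrite big_ord0; exact: cvg_cst.
rewrite -[X in _ --> X]addr0; apply: (cvg_near_eq _ (cvgD IHn (H n))).
by apply: nearW => i; rewrite big_ord_recr.
Qed.

Lemma poly_momentE (P : {poly R}) w :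
  poly_moment P w = \sum_(k < size P) P`_k * poly_moment (Xn k) w.
Proof.
rewrite /poly_moment; under [RHS]eq_bigr do rewrite mulrA.
rewrite -mulr_suml; congr (_ / _).
under [RHS]eq_bigr do rewrite mulr_sumr.
rewrite exchange_big/=; apply: eq_bigr => i _.
rewrite horner_coef mulr_sumr; apply: eq_bigr => k _.
by rewrite hornerXn mulrCA.
Qed.

Variables v v' : I -> word.
Hypothesis Dv : (fun i => size (v i)) @ D --> \oo.
Hypothesis Dv' : (fun i => size (v' i)) @ D --> \oo.
Hypothesis vv' : forall u,
  word_density R u (v i) - word_density R u (v' i) @[i --> D] --> (0 : R).

Lemma poly_moment_determined (P : {poly R}) :
  poly_moment P (v i) - poly_moment P (v' i) @[i --> D] --> (0 : R).
Proof.
pose d k i := poly_moment (Xn k) (v i) - poly_moment (Xn k) (v' i).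
suff Hd k : d k i @[i --> D] --> (0 : R).
  apply: cvg_near_eq (@cvg_sum0 (fun k i => P`_k * d k i) (size P) _).
    apply: nearW => i; rewrite !(poly_momentE P) -sumrB.
    by apply: eq_bigr => k _; rewrite mulrBr.
  by move=> k; rewrite -[X in _ --> X](mulr0 P`_k); apply: cvgM (cvg_cst _) (Hd k).
have H : first_one_density k (v i) - first_one_density k (v' i)
    @[i --> D] --> (0 : R).
  rewrite /first_one_density; elim: (words k) => [|u s IHs].
    by under eq_fun do rewrite !big_nil subrr; exact: cvg_cst.
  rewrite -[X in _ --> X]addr0.
  apply: (cvg_near_eq _ (cvgD (vv' (true :: u)) IHs)).
  by apply: nearW => i; rewrite !big_cons /= opprD addrACA.
have Hv := moment_first_one_density k Dv.
have Hv' := moment_first_one_density k Dv'.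
suff : d k i @[i --> D] --> (0 - 0 + k.+1%:R^-1 * 0 : R).
  by rewrite subrr mulr0 addr0.
apply: (cvg_near_eq _ (cvgD (cvgB Hv Hv') (cvgM (cvg_cst (k.+1%:R^-1 : R)) H))).
by apply: nearW => i; rewrite /d !fctE /=; ring.
Qed.

Lemma minn_slope (n a b : nat) : (a <= b)%N -> (minn n b + a <= b + minn n a)%N.
Proof. lia. Qed.

Lemma sum_lt_ord n m : \sum_(i < n) ((i < m)%N)%:R = (minn n m)%:R :> R.
Proof.
elim: n => [|n IHn]; first by rewrite big_ord0 min0n.
by rewrite big_ord_recr/= IHn -natrD; congr _%:R; lia.
Qed.

Lemma prefix_freq_sum w m :
  prefix_freq R true w m =
  (\sum_(i < size w) (nth false w i)%:R * ((i < m)%N)%:R) / (size w)%:R.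
Proof.
rewrite /prefix_freq; congr (_ / _).
elim: w m => [|a w IHw] m; first by rewrite big_ord0.
rewrite big_ord_recl/=; case: m => [|m].
  by rewrite take0/= mulr0 add0r big1// => i _; rewrite mulr0.
by rewrite /= natrD IHw mulr1; case: a.
Qed.

(** If [P] is close to a step function at [1 - x] except within distance [eta],
    then the moment of [P] nearly counts the positions below [x]: at most
    [2 eta n + 2] positions fall within the uncontrolled range. *)
Lemma word_cdf_poly (P : {poly R}) (x eta eps : R) w :
  0 <= x <= 1 -> 0 < eta -> 0 <= eps -> 1 <= eta * (size w)%:R ->
  (forall y, 0 <= y <= 1 ->
    [/\ 0 <= P.[y] <= 1, 1 - x + eta <= y -> 1 - eps <= P.[y] &
        y <= 1 - x - eta -> P.[y] <= eps]) ->
  `|poly_moment P w - word_cdf w x| <= eps + 4 * eta.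
Proof.
move=> /andP[x0 x1] eta0 eps0 etan HP; set n := size w in etan.
have n0 : 0 < n%:R :> R.
  rewrite lt_neqAle ler0n andbT eq_sym; apply: contraTN etan => /eqP ->.
  by rewrite mulr0 -ltNge ltr01.
rewrite /word_cdf -/n prefix_freq_sum /poly_moment -/n -mulrBl normrM.
rewrite [X in _ * X]ger0_norm ?invr_ge0 ?ler0n// ler_pdivrMr//.
set m := Num.truncn (x * n%:R).
rewrite (le_trans (weighted_sum_le _ (fun i => P.[1 - i%:R / n%:R])
  (fun i => ((i < m)%N)%:R)))// -/n.
(* Outside of [m1 <= i < m2] the value of [P] is within [eps] of the step. *)
pose m1 := Num.truncn ((x - eta) * n%:R).
pose m2 := (Num.truncn ((x + eta) * n%:R)).+1.
have m12 : (m1 <= m2)%N.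
  by rewrite /m1 /m2 (leq_trans (le_truncn _) (leqnSn _))// ler_pM2r//; lra.
have xn0 : 0 <= x * n%:R by rewrite mulr_ge0// ltW.
have xen0 : 0 <= (x + eta) * n%:R by rewrite mulr_ge0 ?(ltW n0)// addr_ge0// ltW.
have /andP[mx1 mx2] : m%:R <= x * n%:R < m.+1%:R := truncn_itv xn0.
have /andP[m2x1 m2x2] := truncn_itv xen0.
apply: (@le_trans _ _ (\sum_(i < n) (eps + ((i < m2)%N%:R - (i < m1)%N%:R)))).
  apply: ler_sum => -[i /= iN] _; set y := 1 - _.
  have y01 : 0 <= y <= 1.
    by rewrite /y subr_ge0 ler_pdivrMr// mul1r ler_nat ltnW//= lerBlDr lerDl divr_ge0.
  have [/andP[P0 P1] Phi Plo] := HP y y01.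
  have m1m : (m1 <= m)%N by apply: le_truncn; rewrite ler_pM2r//; lra.
  have mm2 : (m <= m2)%N.
    by apply: (leq_trans _ (leqnSn _)); apply: le_truncn; rewrite ler_pM2r//; lra.
  have iyE : i%:R = (1 - y) * n%:R by rewrite /y subKr divfK ?gt_eqF.
  have [im1|im1] := ltnP i m1.
    have im : (i < m)%N by exact: leq_trans m1m.
    rewrite im (leq_trans im mm2) subrr addr0 ler_norml.
    move: im1; rewrite truncn_gt_nat -natr1 iyE => h.
    have : (1 - y) * n%:R <= (x - eta) * n%:R by lra.
    rewrite ler_pM2r// => {}h; have /Phi : 1 - x + eta <= y by lra.
    by rewrite /=; lra.
  have [im2|im2] := ltnP i m2.
    by rewrite ler_norml; case: (i < m)%N => /=; lra.
  rewrite ltnNge (leq_trans mm2 im2) subr0 subr0 addr0 ger0_norm//; apply: Plo.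
  have : (x + eta) * n%:R < (1 - y) * n%:R.
    by rewrite -iyE (lt_le_trans m2x2)// ler_nat.
  by rewrite ltr_pM2r//; lra.
rewrite big_split/= sumrB !sum_lt_ord sumr_const card_ord -mulr_natr.
have H : (minn n m2)%:R - (minn n m1)%:R <= m2%:R - m1%:R :> R.
  by rewrite lerBlDr addrAC lerBrDr -!natrD ler_nat minn_slope.
have m1x : (x - eta) * n%:R < m1.+1%:R by exact: truncnS_gt.
have m2E : m2%:R = (Num.truncn ((x + eta) * n%:R))%:R + 1 :> R by rewrite natr1.
rewrite -natr1 in m1x.
by lra.
Qed.

(** Two families of words with asymptotically equal densities have asymptotically
    equal moments, hence distribution functions, since step functions are limits
    of polynomials away from the step. The index filter is arbitrary because it
    is used for pairs of indices (Cauchy sequences) as well as for sequences. *)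
Lemma word_cdf_determined (x : R) : 0 <= x <= 1 ->
  word_cdf (v i) x - word_cdf (v' i) x @[i --> D] --> (0 : R).
Proof.
move=> x01; apply/cvgrPdist_le => e e0.
have th0 : 0 <= 1 - x by lra.
have e20 : 0 < e / 20 by rewrite divr_gt0.
have [P HP] := step_poly th0 e20 e20.
have big (u : I -> word) : (fun i => size (u i)) @ D --> \oo ->
    \forall i \near D, 1 <= e / 20 * (size (u i))%:R.
  move=> Du.
  have Du' : \forall i \near D, (Num.truncn (20 / e) < size (u i))%N.
    exact: (Du _ (nbhs_infty_gt _)).
  apply: filterS Du' => i Hi.
  rewrite -ler_pdivrMl// mulr1 invf_div.
  by rewrite ltW// (lt_le_trans (truncnS_gt _))// ler_nat.
have := big _ Dv; have := big _ Dv'.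
have /cvgrPdist_le/(_ _ e20) := poly_moment_determined P.
apply: filterS3 => i H1 H2 H3.
have := word_cdf_poly x01 e20 (ltW e20) H2 HP.
have := word_cdf_poly x01 e20 (ltW e20) H3 HP.
move: H1; rewrite !sub0r !normrN !ler_norml; lra.
Qed.

End determination.

(** * Densities of a function as iterated integrals *)

Local Notation completed_lebesgue R := (@completed_lebesgue_measure R).

Lemma measurable_completed (R : realType) (A : set R) :
  measurable (A : set (measurableTypeR R)) ->
  measurable (A : set (lebesgueTypeR R)).
Proof. by move=> mA; exact: sub_caratheodory. Qed.

Lemma measurable_itv_completed (R : realType) (i : interval R) :
  measurable ([set` i] : set (lebesgueTypeR R)).
Proof. by apply: measurable_completed; exact: measurable_itv. Qed.

Lemma measurable_id_completed (R : realType) :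
  measurable_fun setT ((fun x => x) : lebesgueTypeR R -> measurableTypeR R).
Proof. by move=> _ Y mY; rewrite setTI; exact: measurable_completed. Qed.

Lemma completed_lebesgue_measureE (R : realType) (A : set R) :
  completed_lebesgue_measure A = lebesgue_measure A :> \bar R.
Proof. by []. Qed.

Lemma completed_lebesgue_measure_oc (R : realType) (a b : R) : a <= b ->
  completed_lebesgue R `]a, b]%classic = (b - a)%:E.
Proof.
move=> ab; rewrite completed_lebesgue_measureE lebesgue_measure_itv/= lte_fin.
by case: ltgtP ab => // -> _; rewrite subrr.
Qed.

(** The two measures agree on Borel sets, so the completion is the Lebesgue
    measure seen through the identity map. *)
Lemma integral_completed (R : realType) (f : R -> \bar R) (A : set R) :
  measurable (A : set (measurableTypeR R)) ->
  measurable_fun (A : set (measurableTypeR R)) (f : measurableTypeR R -> \bar R) ->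
  (forall x, A x -> 0 <= f x)%E ->
  (\int[completed_lebesgue R]_(x in A) f x =
   \int[@lebesgue_measure R]_(x in A) f x)%E.
Proof.
move=> mA mf f0.
have := @ge0_integral_pushforward _ _ _ _ R _ (@measurable_id_completed R)
  (completed_lebesgue R) A f mA mf.
move=> <-; last by move=> x; rewrite inE; exact: f0.
by apply: eq_measure_integral => //; exact: measurable_id_completed.
Qed.

(** Cutting the letters off outside of the unit interval spares the constraint
    that the variables lie in it. *)
Definition unit_letter (R : realType) (f : R -> R) (b : bool) (x : R) : R :=
  if 0 <= x <= 1 then letter_fun f b x else 0.

Section unit_letter.
Variables (R : realType) (f : R -> R).
Hypothesis Wf : limit_space f.
Local Notation L := (lebesgueTypeR R).

Lemma unit_letter_bound b x : 0 <= unit_letter f b x <= 1.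
Proof.
rewrite /unit_letter; case: ifP => [x01|]; last by rewrite lexx ler01.
have := Wf.2 x x01; rewrite /letter_fun; case: b; lra.
Qed.

Lemma measurable_unit_letter b :
  measurable_fun setT (unit_letter f b : L -> R).
Proof.
have -> : unit_letter f b = (letter_fun f b : L -> R) \_ (`[0, 1]%classic : set R).
  by apply/funext => x; rewrite /unit_letter patchE mem_setE in_itv.
apply: (iffLR (measurable_restrictT (letter_fun f b : L -> R)
  (measurable_itv_completed `[0, 1]))).
rewrite /letter_fun; case: b; first exact: Wf.1.
by apply: measurable_funB => //; exact: Wf.1.
Qed.

(** The integrand of [fun_density], cut off outside of [x < t_1 < .. < t_l]. The
    recursion on [u] matches the recursive definition of the measure on tuples,
    and the free left end [x] becomes the variable of the outer integral. *)
Fixpoint chain_integrand (u : word) (x : R) (t : seq R) : R :=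
  match u, t with
  | b :: u', y :: t' => if x < y then unit_letter f b y * chain_integrand u' y t' else 0
  | [::], _ => 1
  | _, _ => 0
  end.

Lemma chain_integrand_ge0 u x t : 0 <= chain_integrand u x t.
Proof.
elim: u x t => [|b u IHu] x [|y t] //=; case: ifP => // _; rewrite mulr_ge0//.
by case/andP: (unit_letter_bound b y).
Qed.

Lemma measurable_chain_integrand u :
  measurable_fun setT (fun p : L * (size u).-tuple L =>
    chain_integrand u (p.1 : R) (tval p.2)).
Proof.
elim: u => [|b u IHu]; first exact: measurable_cst.
pose y (p : L * (size u).+1.-tuple L) : L := tnth p.2 ord0.
have my : measurable_fun setT y.
  exact: measurableT_comp (measurable_tnth _) measurable_snd.
rewrite (_ : (fun p => _) = (fun p : L * (size u).+1.-tuple L =>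
   if (p.1 : R) < y p then unit_letter f b (y p) *
     chain_integrand u (y p : R) (tval [tuple of behead p.2]) else 0)); last first.
  by apply/funext => -[x t]; rewrite /y /=; case/tupleP: t => z t; rewrite tnth0.
apply: measurable_fun_ifT; last exact: measurable_cst.
  apply: measurable_fun_ltr; apply: measurableT_comp (@measurable_id_completed R) _.
    exact: measurable_fst.
  exact: my.
apply: measurable_funM.
- exact: measurableT_comp (measurable_unit_letter b) my.
- pose g (p : L * (size u).+1.-tuple L) : L * (size u).-tuple L :=
    (y p, [tuple of behead p.2]).
  have mg : measurable_fun setT g.
    apply: measurable_fun_pair => //.
    exact: measurableT_comp (@measurable_behead _ L (size u)) measurable_snd.
  exact: measurableT_comp IHu mg.
Qed.

Lemma chain_integrandE u x t : size t = size u ->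
  chain_integrand u x t =
  if path <%R x t && all (fun y => 0 <= y <= 1) t
  then \prod_(i < size u) letter_fun f (nth false u i) (nth 0 t i) else 0.
Proof.
elim: u x t => [|b u IHu] x [|y t] //=; first by rewrite big_ord0.
move=> [st]; rewrite IHu// big_ord_recl /= /unit_letter.
case: (x < y) => //=; case: (0 <= y <= 1) => /=; last by rewrite andbF mul0r.
by case: ifP; rewrite ?mulr0.
Qed.

(** The starting point [-1] stands for the absence of a lower bound: it is below
    every point of the unit interval, including [0]. *)
Lemma ordered_simplexP l (t : l.-tuple L) :
  ordered_simplex t <->
  path <%R (-1 : R) (tval t) && all (fun y : R => 0 <= y <= 1) (tval t).
Proof.
rewrite (path_sortedE lt_trans) -andbA (sorted_pairwise lt_trans).
split=> [[t01 tlt]|/and3P[_ /(pairwiseP 0) tlt /all_tnthP t01]].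
  have t01' : all (fun y : R => 0 <= y <= 1) (tval t) by exact/all_tnthP.
  apply/and3P; split=> //.
    by apply: sub_all t01' => y /andP[y0 _] /=; rewrite (lt_le_trans _ y0)// ltrN10.
  apply/(pairwiseP 0) => i j; rewrite !inE size_tuple => il jl ij.
  by have := tlt (Ordinal il) (Ordinal jl) ij; rewrite !(tnth_nth 0).
split=> // i j ij; rewrite !(tnth_nth 0).
by apply: tlt => //; rewrite inE size_tuple.
Qed.

Local Open Scope ereal_scope.

Definition nested_integral (u : word) (x : R) : \bar R :=
  \int[lebesgue_tuple R (size u)]_t (chain_integrand u x (tval t))%:E.

Lemma fun_density_nested (u : word) :
  fun_density u f = ((size u)`!%:R * fine (nested_integral u (-1)))%R.
Proof.
rewrite /fun_density /Rintegral integral_mkcond; congr (_ * fine _)%R.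
apply: eq_integral => t _; rewrite chain_integrandE ?size_tuple// patchE.
have -> : (t \in @ordered_simplex R (size u)) = path <%R (-1)%R (tval t) &&
    all (fun y : R => 0 <= y <= 1)%R (tval t).
  by apply/idP/idP; rewrite inE => /ordered_simplexP.
case: ifP => // _; congr EFin; apply: eq_bigr => i _.
by rewrite (tnth_nth false) (tnth_nth 0%R).
Qed.

Lemma nested_integral_nil x : nested_integral [::] x = 1.
Proof.
by rewrite /nested_integral /= integral_cst// mul1e; exact: diracT.
Qed.

Lemma nested_integral_ge0 u x : 0 <= nested_integral u x.
Proof. by apply: integral_ge0 => t _; rewrite lee_fin chain_integrand_ge0. Qed.

Lemma measurable_nested_integral u :
  measurable_fun setT (nested_integral u : L -> \bar R).
Proof.
apply: (measurable_fun_fubini_tonelli_F (m2 := lebesgue_tuple R (size u))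
  (fun p : L * (size u).-tuple L => (chain_integrand u (p.1 : R) (tval p.2))%:E)).
  by apply/measurable_EFinP; exact: measurable_chain_integrand.
by move=> p; rewrite lee_fin chain_integrand_ge0.
Qed.

(** Tonelli's theorem, the first variable being integrated last. *)
Lemma nested_integral_cons b u x : nested_integral (b :: u) x =
  \int[completed_lebesgue R]_(y in `]x, +oo[)
    ((unit_letter f b y)%:E * nested_integral u y).
Proof.
rewrite /nested_integral /=.
have mcons : measurable_fun setT
   (fun p : L * (size u).-tuple L => [tuple of p.1 :: p.2]).
  exact: (@measurable_cons _ _ (L * (size u).-tuple L)%type L fst (size u) snd
    measurable_fst measurable_snd).
have mint : measurable_fun setT (fun t : (size u).+1.-tuple L =>
    (chain_integrand (b :: u) x (tval t))%:E).
  apply/measurable_EFinP.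
  have mpair : measurable_fun setT (fun t : (size u).+1.-tuple L => (x : L, t)).
    by apply: measurable_fun_pair => //; exact: measurable_cst.
  exact: measurableT_comp (measurable_chain_integrand (u := b :: u)) mpair.
rewrite /= (ge0_integral_pushforward mcons)//; last first.
  by move=> t _; rewrite lee_fin; exact: (chain_integrand_ge0 (b :: u) x (tval t)).
rewrite preimage_setT (fubini_tonelli1 (m2 := lebesgue_tuple R (size u))); last 2 first.
- exact: measurableT_comp mint mcons.
- move=> p; rewrite lee_fin.
  exact: (chain_integrand_ge0 (b :: u) x (p.1 :: tval p.2)).
rewrite [RHS]integral_mkcond; apply: eq_integral => y _.
rewrite /fubini_F /= patchE mem_setE in_itv /= andbT; case: ifP => _; last first.
  by rewrite integral0.
under eq_integral do rewrite EFinM.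
rewrite ge0_integralZl//.
- apply/measurable_EFinP.
  have mpair : measurable_fun setT (fun t : (size u).-tuple L => (y : L, t)).
    by apply: measurable_fun_pair => //; exact: measurable_cst.
  exact: measurableT_comp (measurable_chain_integrand (u := u)) mpair.
- by move=> t _; rewrite lee_fin chain_integrand_ge0.
- by rewrite lee_fin; case/andP: (unit_letter_bound b y).
Qed.

End unit_letter.

Section nested_tails_of_function.
Variables (R : realType) (f : R -> R).
Hypothesis Wf : limit_space f.
Local Notation L := (lebesgueTypeR R).
Local Notation lam := (@completed_lebesgue_measure R).
Local Open Scope ereal_scope.

Let ul b (y : R) : \bar R := (unit_letter f b y)%:E.

Let ul_ge0 b y : 0 <= ul b y.
Proof. by rewrite lee_fin; case/andP: (unit_letter_bound Wf b y). Qed.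

Let ul_le1 b y : ul b y <= 1.
Proof. by rewrite lee_fin; case/andP: (unit_letter_bound Wf b y). Qed.

Let measurable_ul b (D : set L) : measurable_fun D (ul b : L -> \bar R).
Proof.
by apply: measurable_funTS; apply/measurable_EFinP; exact: measurable_unit_letter.
Qed.

Definition letter_mass b (x z : R) : \bar R :=
  \int[lam]_(y in (`]x, z]%classic : set R)) ul b y.

Let mitv (i : interval R) : measurable ([set` i] : set L).
Proof. exact: measurable_itv_completed. Qed.

Lemma letter_mass_ge0 b x z : 0 <= letter_mass b x z.
Proof. by apply: integral_ge0 => y _; exact: ul_ge0. Qed.

Lemma letter_mass_le b x z : (x <= z)%R -> letter_mass b x z <= (z - x)%:E.
Proof.
move=> xz; apply: (@le_trans _ _ (\int[lam]_(y in (`]x, z]%classic : set R)) cst 1 y)).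
  by apply: ge0_le_integral => //; exact: measurable_cst.
by rewrite integral_cst//= mul1e -completed_lebesgue_measure_oc.
Qed.

Lemma letter_mass_fin b x z : (x <= z)%R -> letter_mass b x z \is a fin_num.
Proof.
move=> xz; rewrite ge0_fin_numE ?letter_mass_ge0//.
by rewrite (le_lt_trans (letter_mass_le b xz))// ltry.
Qed.

Lemma integral_oc_split (g : L -> \bar R) (x z : R) (c : itv_bound R) :
  (x <= z)%R -> (BRight z <= c)%O ->
  measurable_fun setT g -> (forall y, 0 <= g y) ->
  \int[lam]_(y in ([set` Interval (BRight x) c] : set R)) g y =
  \int[lam]_(y in (`]x, z]%classic : set R)) g y +
  \int[lam]_(y in ([set` Interval (BRight z) c] : set R)) g y.
Proof.
move=> xz zc mg g0; rewrite -ge0_integral_setU//=.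
- by rewrite -itv_bndbnd_setU// bnd_simp.
- exact: measurable_funTS.
- apply/disj_setPS => y [] /=; rewrite !in_itv /= => /andP[_ yz].
  by case: c {zc} => [[] c|[]] //=; rewrite ?andbF// ltNge yz.
Qed.

Lemma letter_massD b x y z : (x <= y)%R -> (y <= z)%R ->
  letter_mass b x z = letter_mass b x y + letter_mass b y z.
Proof. by move=> xy yz; apply: integral_oc_split. Qed.

Lemma letter_mass_sum x z : (0 <= x)%R -> (x <= z)%R -> (z <= 1)%R ->
  letter_mass true x z + letter_mass false x z = (z - x)%:E.
Proof.
move=> x0 xz z1; rewrite /letter_mass -ge0_integralD//.
rewrite -completed_lebesgue_measure_oc// -[RHS]mul1e -integral_cst//.
apply: eq_integral => y; rewrite inE/= in_itv/= => /andP[xy yz].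
rewrite /ul /unit_letter.
have -> : (0 <= y <= 1)%R.
  by rewrite (le_trans x0 (ltW xy)) (le_trans yz z1).
by rewrite -EFinD /letter_fun addrC subrK.
Qed.

Definition cdf (x : R) : R := fine (letter_mass true 0 x).

Lemma letter_massE b x z : (0 <= x)%R -> (x <= z)%R -> (z <= 1)%R ->
  letter_mass b x z = (letter_cdf cdf b z - letter_cdf cdf b x)%:E.
Proof.
move=> x0 xz z1; have z0 := le_trans x0 xz.
have H : letter_mass true x z = (cdf z - cdf x)%:E.
  rewrite /cdf (letter_massD _ x0 xz) fineD ?letter_mass_fin//.
  by rewrite addrC addKr fineK ?letter_mass_fin.
case: b => //; have := letter_mass_sum x0 xz z1.
rewrite H -(fineK (letter_mass_fin false xz)) -EFinD => -[] E.
by congr EFin; rewrite /letter_cdf; lra.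
Qed.

Lemma slope_unit_cdf : slope_unit cdf.
Proof.
move=> x y x0 xy y1; have := letter_massE true x0 xy y1; rewrite /letter_cdf => H.
rewrite -!lee_fin -H letter_mass_ge0/=; exact: letter_mass_le.
Qed.

Lemma cdf0 : cdf 0 = 0%R.
Proof. by rewrite /cdf /letter_mass set_itvoc0 integral_set0. Qed.

Local Notation N := (nested_integral f).

Let mN u (D : set L) : measurable_fun D (N u : L -> \bar R).
Proof. by apply: measurable_funTS; exact: measurable_nested_integral. Qed.

Let measurable_ulN b u (D : set L) : measurable_fun D (fun y : L => ul b y * N u y).
Proof. by apply: emeasurable_funM. Qed.

Let ulN_ge0 b u y : 0 <= ul b y * N u y.
Proof. by rewrite mule_ge0 ?nested_integral_ge0. Qed.

Lemma nested_integral_split b u x z : (x <= z)%R ->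
  N (b :: u) x = \int[lam]_(y in (`]x, z]%classic : set R)) (ul b y * N u y)
                 + N (b :: u) z.
Proof.
move=> xz; rewrite (nested_integral_cons Wf b u x) (nested_integral_cons Wf b u z).
exact: (@integral_oc_split (fun y => ul b y * N u y) x z +oo%O).
Qed.

Lemma nested_integral_noninc u x z : (x <= z)%R -> N u z <= N u x.
Proof.
case: u => [|b u] xz; first by rewrite !nested_integral_nil.
by rewrite (nested_integral_split b u xz) leeDr// integral_ge0.
Qed.

Lemma nested_integral_le1 u x : N u x <= 1.
Proof.
elim: u x => [|b u IHu] x; first by rewrite nested_integral_nil.
rewrite (nested_integral_cons Wf).
apply: (@le_trans _ _
  (\int[lam]_(y in (`]x, +oo[%classic : set R)) (\1_(`[0%R, 1%R]%classic : set R) y)%:E)).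
  apply: ge0_le_integral.
  - exact: mitv.
  - by move=> y _; exact: ulN_ge0.
  - exact: measurable_ulN.
  - by apply/measurable_EFinP; apply: measurable_indic; exact: mitv.
  - move=> y _; rewrite indicE mem_setE in_itv /=.
    have : ul b y * N u y <= 1.
      rewrite -[leRHS]mul1e; apply: lee_pmul (ul_ge0 b y) _ (ul_le1 b y) (IHu y).
      exact: nested_integral_ge0.
    by rewrite /ul /unit_letter; case: ifP => // _ _; rewrite mul0e.
rewrite integral_indic// (@le_trans _ _ (lam (`[0%R, 1%R]%classic : set R)))//.
  apply: le_measure; rewrite ?inE.
  - by apply: measurableI; exact: mitv.
  - exact: mitv.
  - exact: subIsetl.
by rewrite completed_lebesgue_measureE lebesgue_measure_itv/= lte_fin ltr01 oppr0 adde0.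
Qed.

Lemma nested_integral_fin u x : N u x \is a fin_num.
Proof.
rewrite ge0_fin_numE ?nested_integral_ge0//.
by rewrite (le_lt_trans (nested_integral_le1 u x))// ltry.
Qed.

Lemma nested_integral_end b u : N (b :: u) 1 = 0.
Proof.
rewrite (nested_integral_cons Wf); apply: integral0_eq => y /=.
by rewrite in_itv/= andbT => y1; rewrite /unit_letter (lt_geF y1) andbF mul0e.
Qed.

(** Between [-1] and [0] the letters only live at the point [0]. *)
Lemma nested_integral_start u : N u (-1) = N u 0.
Proof.
case: u => [|b u]; first by rewrite !nested_integral_nil.
have n10 : (-1 <= 0 :> R)%R by exact: lerN10.
rewrite (nested_integral_split b u n10) -[RHS]add0e; congr (_ + _).
apply/eqP; rewrite eq_le; apply/andP; split; last first.
  by apply: integral_ge0 => y _; exact: ulN_ge0.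
apply: (@le_trans _ _
  (\int[lam]_(y in (`](-1)%R, 0%R]%classic : set R))
    (\1_(`[0%R, 0%R]%classic : set R) y)%:E)).
  apply: ge0_le_integral.
  - exact: mitv.
  - by move=> y _; exact: ulN_ge0.
  - exact: measurable_ulN.
  - by apply/measurable_EFinP; apply: measurable_indic; exact: mitv.
  - move=> y /=; rewrite in_itv/= => /andP[_ y0].
    have : ul b y * N u y <= 1.
      rewrite -[leRHS]mul1e.
      apply: lee_pmul (ul_ge0 b y) _ (ul_le1 b y) (nested_integral_le1 u y).
      exact: nested_integral_ge0.
    rewrite indicE mem_setE in_itv/= y0 andbT /ul /unit_letter.
    by case: (leP 0%R y) => //= _ _; rewrite mul0e.
rewrite integral_indic// (@le_trans _ _ (lam (`[0%R, 0%R]%classic : set R)))//.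
  apply: le_measure; rewrite ?inE.
  - by apply: measurableI; exact: mitv.
  - exact: mitv.
  - exact: subIsetl.
by rewrite completed_lebesgue_measureE lebesgue_measure_itv/= lte_fin ltxx.
Qed.

Lemma nested_tails_cdf : nested_tails cdf (fun u x => fine (N u x)).
Proof.
split.
- by move=> x; rewrite nested_integral_nil.
- by move=> b u; rewrite nested_integral_end.
- move=> u x; rewrite -!lee_fin fineK ?nested_integral_fin//.
  by rewrite nested_integral_ge0//= nested_integral_le1.
move=> b u x z x0 xz z1.
rewrite (nested_integral_split b u xz).
set A := \int[lam]_(y in _) _.
have mxz := letter_massE b x0 xz z1.
have A1 : letter_mass b x z * N u z <= A.
  rewrite muleC /letter_mass -ge0_integralZl//; last exact: nested_integral_ge0.
  apply: ge0_le_integral.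
  - exact: mitv.
  - by move=> y _; rewrite mule_ge0 ?nested_integral_ge0.
  - by apply: emeasurable_funM; [exact: measurable_cst|exact: measurable_ul].
  - exact: measurable_ulN.
  - move=> y /=; rewrite in_itv/= => /andP[_ yz]; rewrite muleC.
    by apply: lee_wpmul2l; [exact: ul_ge0|exact: nested_integral_noninc].
have A2 : A <= letter_mass b x z * N u x.
  rewrite muleC /letter_mass -ge0_integralZl//; last exact: nested_integral_ge0.
  apply: ge0_le_integral.
  - exact: mitv.
  - by move=> y _; exact: ulN_ge0.
  - exact: measurable_ulN.
  - by apply: emeasurable_funM; [exact: measurable_cst|exact: measurable_ul].
  - move=> y /=; rewrite in_itv/= => /andP[/ltW xy _]; rewrite [leRHS]muleC.
    by apply: lee_wpmul2l; [exact: ul_ge0|exact: nested_integral_noninc].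
have A0 : 0 <= A by apply: integral_ge0 => y _; exact: ulN_ge0.
have Af : A \is a fin_num.
  rewrite ge0_fin_numE// (le_lt_trans A2)// -ge0_fin_numE.
    by rewrite fin_numM ?letter_mass_fin ?nested_integral_fin.
  by rewrite mule_ge0 ?letter_mass_ge0 ?nested_integral_ge0.
rewrite (fineD Af (nested_integral_fin (b :: u) z)).
rewrite addrK -!lee_fin (fineK Af) !EFinM -mxz.
by rewrite !fineK ?nested_integral_fin// A1 A2.
Qed.

Lemma fun_density_cdf u :
  fun_density u f = ((size u)`!%:R * fine (N u 0))%R.
Proof. by rewrite fun_density_nested// nested_integral_start. Qed.

End nested_tails_of_function.

(** * Functions with a given primitive *)

Section clamp.
Variable R : realType.

Definition clamp (t : R) : R := Num.max 0 (Num.min t 1).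

Lemma clamp01 t : 0 <= clamp t <= 1.
Proof. by rewrite le_max lexx ge_max ler01 ge_min lexx orbT. Qed.

Lemma clamp_slope x y : x <= y -> clamp x <= clamp y /\ clamp y - clamp x <= y - x.
Proof.
by move=> xy; rewrite /clamp /Num.max /Num.min; split; repeat case: ifP => //; lra.
Qed.

Lemma clamp_id x : 0 <= x <= 1 -> clamp x = x.
Proof. by move=> /andP[x0 x1]; rewrite /clamp (min_idPl x1) (max_idPr x0). Qed.

End clamp.

Section density_of_cdf.
Variables (R : realType) (F : R -> R).
Hypothesis HF : slope_unit F.
Local Notation mu := (@lebesgue_measure R).

Definition clamped (x : R) : R := F (clamp x).

Lemma clamped_slope x y : x <= y -> 0 <= clamped y - clamped x <= y - x.
Proof.
move=> /clamp_slope[cxy cyx].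
have /andP[cx0 _] := clamp01 x; have /andP[_ cy1] := clamp01 y.
have /andP[-> H] /= := HF cx0 cxy cy1.
exact: le_trans H cyx.
Qed.

Let clamped_nd : {homo clamped : x y / x <= y}.
Proof. by move=> x y /clamped_slope/andP[+ _]; rewrite subr_ge0. Qed.

Let clamped_rc : right_continuous clamped.
Proof.
apply: right_continuousW => x; apply/cvgrPdist_le => e e0.
have Hx : \forall y \near x, `|x - y| <= e.
  have /cvgrPdist_le : (fun y => y) @ x --> x by exact: cvg_id.
  exact.
near=> y.
have H : `|clamped x - clamped y| <= `|x - y|.
  have [/clamped_slope|/ltW/clamped_slope] := leP x y.
    by rewrite (distrC x) (distrC (clamped x)) => /andP[h1 h2]; rewrite !ger0_norm//; lra.
  by move=> /andP[h1 h2]; rewrite !ger0_norm//; lra.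
by rewrite (le_trans H)//; near: y.
Unshelve. all: by end_near. Qed.

Definition clamped_cumulative : cumulative R R := HB.pack_for (cumulative R R) clamped
  (isCumulative.Build R _ R clamped clamped_nd clamped_rc).

Local Notation Fc := clamped_cumulative.
Local Notation muF := (lebesgue_stieltjes_measure Fc).
Local Open Scope ereal_scope.

Lemma clamped_stieltjes_oc (a b : R) : (a <= b)%R ->
  muF (`]a, b]%classic : set R) = (clamped b - clamped a)%:E.
Proof.
move=> ab; rewrite -(wlength_itv_bnd clamped false false ab).
exact: (measurable_mu_extE (wlength Fc) (is_ocitv a b)).
Qed.

(** Both measures are infima over covers by intervals, and an interval is at
    most as heavy for [clamped] as for the Lebesgue measure. *)
Let muF_le (A : set R) : muF A <= mu A.
Proof.
apply: le_ereal_inf_tmp => _ [B [mB AB] <-].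
apply: (@le_trans _ _ (\sum_(k <oo) wlength Fc (B k))).
  by apply: ereal_inf_lbound; exists B.
apply: lee_nneseries => [k _ _|k _]; first exact: (wlength_ge0 Fc).
have [[a b] _ <-] := mB k.
have [ab|ab] := leP a b; last by rewrite set_itv_ge ?wlength0// bnd_simp -leNgt ltW.
rewrite /= (wlength_itv_bnd Fc)// (wlength_itv_bnd idfun)// lee_fin.
by have /andP[] := clamped_slope ab.
Qed.

Let D : set (measurableTypeR R) := (`]0%R, 1%R]%classic : set R).

Let mD : measurable D. Proof. exact: measurable_itv. Qed.

Let muFD : muF D < +oo.
Proof. by rewrite clamped_stieltjes_oc ?ler01// ltry. Qed.

(** The Stieltjes measure of [F] is dominated by the Lebesgue measure, so it has a
    density [g]. On the set where [g > 1] every Borel subset [B] satisfies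
    [mu B <= \int_B g = muF B <= mu B], so that [g = 1] almost everywhere there,
    and truncating [g] at [1] changes nothing. *)
Lemma cdf_density : F 0 = 0%R -> exists f : R -> R, limit_space f /\
  forall x, (0 <= x <= 1)%R -> cdf f x = F x.
Proof.
move=> F0.
have dom : mfrestr mD muFD `<< mu.
  apply/null_content_dominatesP => A mA A0.
  apply/eqP; rewrite eq_le measure_ge0 andbT -A0 /mfrestr /mrestr.
  apply: (le_trans (muF_le _)); apply: le_measure; rewrite ?inE.
  - by apply: measurableI => //; exact: mD.
  - exact: mA.
  - exact: subIsetl.
have [g [g0 gfin gint gE]] := radon_nikodym_sigma_finite dom.
have mg : measurable_fun setT g by exact: measurable_int gint.
have gle A : measurable A -> A `<=` D -> \int[mu]_(x in A) g x = muF A.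
  move=> mA AD; transitivity (muF (A `&` D)); last by rewrite (setIidl AD).
  by rewrite -(gE A mA).
pose f x := Num.min (fine (g x)) 1%R.
have mf : measurable_fun setT (f : measurableTypeR R -> R).
  by apply: measurable_minr => //; apply: measurableT_comp => //; exact: measurable_fine.
have f01 x : (0 <= f x <= 1)%R.
  by rewrite /f le_min fine_ge0// ler01/= ge_min lexx orbT.
have Wf : limit_space f.
  split; last by move=> x _; exact: f01.
  apply: measurable_funTS; exact: measurableT_comp mf (@measurable_id_completed R).
exists f; split=> // x /andP[x0 x1].
pose E := D `&` [set y | 1 < g y].
have mE : measurable E.
  by apply: measurable_lte; [exact: mD|exact: measurable_cst|exact: measurable_funTS].
have muD : mu D < +oo.
  by rewrite lebesgue_measure_itv/= lte_fin ltr01 ltry.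
have gE1 : ae_eq mu E (cst 1) g.
  apply: integral_ae_eq => //.
  - apply/integrableP; split; first exact: measurable_cst.
    rewrite (eq_integral (cst 1)) => [|y _]; last by rewrite /= normr1.
    rewrite integral_cst// mul1e (le_lt_trans _ muD)//.
    by apply: le_measure; rewrite ?inE; [exact: mE|exact: mD|exact: subIsetl].
  - exact: measurable_funTS.
  move=> B BE mB; apply/eqP; rewrite eq_le; apply/andP; split.
    apply: ge0_le_integral.
    + exact: mB.
    + by move=> y _; exact: lee01.
    + exact: measurable_cst.
    + exact: measurable_funTS.
    + by move=> y /BE [_ /ltW].
  rewrite gle//; last by move=> y /BE [].
  by rewrite integral_cst// mul1e; exact: muF_le.
have xD : (`]0%R, x]%classic : set R) `<=` D.
  by move=> y; rewrite /D /= !in_itv/= => /andP[y0 yx]; rewrite y0 (le_trans yx x1).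
rewrite /cdf /letter_mass.
transitivity (fine (\int[mu]_(y in (`]0%R, x]%classic : set R)) (f y)%:E)).
  congr fine; rewrite -integral_completed//.
  - apply: eq_integral => y; rewrite inE/= in_itv/= => /andP[y0 yx].
    by rewrite /unit_letter ltW// (le_trans yx x1).
  - by apply/measurable_EFinP; exact: measurable_funTS.
  - by move=> y _; rewrite lee_fin; case/andP: (f01 y).
rewrite (@ae_eq_integral _ _ _ _ _ g)//; last first.
- case: gE1 => N [mN N0 HN]; exists N; split=> // y /= H; apply: HN => /= H'.
  apply: H => yx; have yD := xD _ yx.
  have [g1|g1] := leP (g y) 1.
    rewrite /f; have : (fine (g y) <= 1)%R by rewrite -lee_fin fineK.
    by move=> /min_idPl ->; rewrite fineK.
  by rewrite /f -(H' (conj yD g1)) /= minxx.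
- exact: measurable_funTS.
- by apply/measurable_EFinP; exact: measurable_funTS.
rewrite gle// clamped_stieltjes_oc//= /clamped clamp_id ?x0// clamp_id ?lexx ?ler01//.
by rewrite F0 subr0.
Qed.

End density_of_cdf.

(** * Uniqueness of the function with a given primitive *)

Section cdf_determines_function.
Variable R : realType.
Local Notation L := (lebesgueTypeR R).
Local Notation lam := (@completed_lebesgue_measure R).
Local Notation mu := (@lebesgue_measure R).
Local Open Scope ereal_scope.

(** Without the end point [0], the product with the indicator function of
    [`]a, b]] depends only on [clamp a] and [clamp b]. *)
Definition oc_restriction (f : R -> R) : R -> R := f \_ (`]0%R, 1%R]%classic : set R).

Section mass.
Variable f : R -> R.
Hypothesis Wf : limit_space f.

Let V (y : R) : \bar R := (oc_restriction f y)%:E.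

Lemma oc_restriction_bound y : (0 <= oc_restriction f y <= 1)%R.
Proof.
rewrite /oc_restriction patchE mem_setE in_itv/=.
case: ifP => [/andP[y0 y1]|_]; last by rewrite lexx ler01.
by apply: Wf.2; rewrite ltW.
Qed.

Lemma measurable_oc_restriction : measurable_fun setT (oc_restriction f : L -> R).
Proof.
apply: (iffLR (measurable_restrictT (f : L -> R)
  (measurable_itv_completed `]0%R, 1%R]))).
apply: measurable_funS Wf.1; first exact: measurable_itv_completed.
by move=> y /=; rewrite !in_itv/= => /andP[y0 ->]; rewrite ltW.
Qed.

Let mV : measurable_fun setT (V : L -> \bar R).
Proof. by apply/measurable_EFinP; exact: measurable_oc_restriction. Qed.

Let V0 y : 0 <= V y.
Proof. by rewrite lee_fin; case/andP: (oc_restriction_bound y). Qed.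

Definition oc_mass (A : set (measurableTypeR R)) : \bar R :=
  \int[lam]_(y in (A : set R)) V y.

Let oc_mass0 : oc_mass set0 = 0.
Proof. exact: integral_set0. Qed.

Let oc_mass_ge0 A : 0 <= oc_mass A.
Proof. by apply: integral_ge0. Qed.

Let oc_mass_sigma_additive : semi_sigma_additive oc_mass.
Proof.
move=> A mA tA mUA; apply: (semi_sigma_additive_nng_induced (mu := lam) mV V0) => //.
  by move=> n; exact: measurable_completed.
exact: measurable_completed.
Qed.

Let nu : {measure set (measurableTypeR R) -> \bar R} :=
  HB.pack_for {measure set (measurableTypeR R) -> \bar R} oc_mass
    (isMeasure.Build _ _ _ oc_mass oc_mass0 oc_mass_ge0 oc_mass_sigma_additive).

Let oc_mass_oc (a b : R) : (a <= b)%R ->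
  oc_mass `]a, b]%classic = (clamped (cdf f) b - clamped (cdf f) a)%:E.
Proof.
move=> ab; have [cab _] := clamp_slope ab.
have /andP[ca0 _] := clamp01 a; have /andP[_ cb1] := clamp01 b.
rewrite -[RHS](letter_massE Wf true ca0 cab cb1).
rewrite /letter_mass /oc_mass [LHS]integral_mkcond [RHS]integral_mkcond.
apply: eq_integral => y _; rewrite !patchE !mem_setE !in_itv/=.
rewrite /V /oc_restriction patchE mem_setE in_itv/= /unit_letter /=.
have [y0|y0] := ltP 0%R y; last by rewrite if_same ltNge (le_trans y0 ca0).
have [y1|y1] := leP y 1%R; last first.
  by rewrite /= if_same (leNgt y (clamp b)) (le_lt_trans cb1 y1) /= andbF.
have -> : (clamp a < y)%R = (a < y)%R by rewrite /clamp gt_max y0/= gt_min (le_gtF y1) orbF.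
have -> : (y <= clamp b)%R = (y <= b)%R.
  by rewrite /clamp le_max (lt_geF y0)/= le_min y1 andbT.
by rewrite (ltW y0).
Qed.

(** Both measures give each interval [`]a, b]] the increment of [clamped F]. *)
Lemma stieltjes_oc_mass (F : R -> R) (HF : slope_unit F) (A : set (measurableTypeR R)) :
  (forall x, (0 <= x <= 1)%R -> F x = cdf f x) -> measurable A ->
  lebesgue_stieltjes_measure (clamped_cumulative HF) A = oc_mass A.
Proof.
move=> FE mA; apply: (lebesgue_stieltjes_measure_unique (mu := nu)) => //.
have cE t : clamped F t = clamped (cdf f) t.
  by apply: FE; exact: clamp01.
move=> _ [[a b] _ <-] /=.
have [ab|ab] := leP a b.
  by rewrite clamped_stieltjes_oc// !cE -oc_mass_oc.
rewrite set_itv_ge ?measure0//; last by rewrite bnd_simp -leNgt ltW.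
Qed.

End mass.

Lemma oc_mass_determined (f g : R -> R) (A : set (measurableTypeR R)) :
  limit_space f -> limit_space g ->
  (forall x, (0 <= x <= 1)%R -> cdf f x = cdf g x) ->
  measurable A -> oc_mass f A = oc_mass g A.
Proof.
move=> Wf Wg fg mA.
rewrite -(stieltjes_oc_mass Wf (slope_unit_cdf Wf))//.
by rewrite (stieltjes_oc_mass Wg).
Qed.

(** The Caratheodory sigma-algebra is the completion of the Borel one. *)
Lemma borel_up_to_null (A : set L) : measurable A ->
  exists2 B : set (measurableTypeR R), measurable B &
    \forall y \ae lam, (A : set R) y <-> (B : set R) y.
Proof.
move=> mA.
have : (completed_algebra_gen mu) (A : set R).
  rewrite -g_sigma_completed_algebra_genE completed_caratheodory_measurable.
  exact: mA.
case=> B mB [N [M [mM M0 NM]] BNA]; exists B => //.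
exists M; split; [exact: measurable_completed|exact: M0|].
move=> y /= H; apply: NM; apply: contrapT => Ny; apply: H.
by rewrite -BNA; split; [case|left].
Qed.

Lemma oc_mass_ae (f : R -> R) (A B : set L) : limit_space f ->
  measurable A -> measurable B -> (\forall y \ae lam, A y <-> B y) ->
  oc_mass f A = oc_mass f B.
Proof.
move=> Wf mA mB AB; rewrite /oc_mass integral_mkcond [RHS]integral_mkcond.
have mV : measurable_fun setT (EFin \o (oc_restriction f : L -> R)).
  by apply/measurable_EFinP; exact: measurable_oc_restriction.
apply: ae_eq_integral.
- exact: measurableT.
- by apply: (iffLR (measurable_restrictT _ mA)); exact: measurable_funTS.
- by apply: (iffLR (measurable_restrictT _ mB)); exact: measurable_funTS.
apply: filterS AB => y AB _; rewrite !patchE.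
by have -> : (y \in A) = (y \in B) by apply/idP/idP; rewrite !inE => /AB.
Qed.

(** Functions with equal integrals over all measurable subsets agree almost
    everywhere. The integrals over intervals are given; those over Borel sets
    follow by uniqueness of the Stieltjes measure, and the others because they
    are Borel up to null sets. *)
Lemma cdf_determines_function (f g : R -> R) :
  limit_space f -> limit_space g ->
  (forall x, (0 <= x <= 1)%R -> cdf f x = cdf g x) ->
  f = g %[ae lam in (`[0%R, 1%R]%classic : set R)].
Proof.
move=> Wf Wg fg; pose D : set L := (`]0%R, 1%R]%classic : set R).
have mD : measurable D by exact: measurable_itv_completed.
have mV h (Wh : limit_space h) : measurable_fun D (EFin \o (oc_restriction h : L -> R)).
  by apply: measurable_funTS; apply/measurable_EFinP; exact: measurable_oc_restriction.
have [N [mN N0 HN]] : ae_eq lam D (EFin \o oc_restriction f) (EFin \o oc_restriction g).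
  apply: integral_ae_eq; [exact: mD| |exact: mV|].
  - apply/integrableP; split; first exact: mV.
    apply: (@le_lt_trans _ _ (\int[lam]_(y in D) cst 1 y)).
      apply: ge0_le_integral; [exact: mD|by []| | |].
      + by apply: measurableT_comp (mV f Wf) => //; exact: measurable_abse.
      + exact: measurable_cst.
      + move=> y _ /=; have /andP[h0 h1] := oc_restriction_bound Wf y.
        by rewrite lee_fin ger0_norm.
    rewrite integral_cst//= mul1e completed_lebesgue_measure_oc ?ler01//.
    exact: ltry.
  move=> E ED mE; have [B mB EB] := borel_up_to_null mE.
  have mB' := measurable_completed mB.
  rewrite -/(oc_mass f E) -/(oc_mass g E).
  rewrite (oc_mass_ae Wf mE mB' EB) (oc_mass_ae Wg mE mB' EB).
  exact: oc_mass_determined.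
have mZ : measurable ((`[0%R, 0%R]%classic : set R) : set L).
  exact: measurable_itv_completed.
have Z0 : lam (`[0%R, 0%R]%classic : set R) = 0.
  by rewrite completed_lebesgue_measureE lebesgue_measure_itv/= lte_fin ltxx.
exists (N `|` (`[0%R, 0%R]%classic : set R)); split.
- exact: measurableU.
- apply/eqP; rewrite eq_le measure_ge0 andbT.
  apply: (le_trans (measureU2 _ mN mZ)).
  by rewrite [X in X + _]N0 [X in _ + X]Z0 adde0.
move=> y /= /not_implyP[]; rewrite in_itv/= => /andP[y0 y1] nfg.
have [yE|yn0] := eqVneq y 0%R; first by right; rewrite yE /= in_itv/= lexx.
have yD : (0 < y <= 1)%R by rewrite lt_neqAle eq_sym yn0 y0.
left; apply: HN => /= H; apply: nfg.
have : D y by rewrite /D /= in_itv.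
by move/H; rewrite /oc_restriction !patchE !mem_setE !in_itv/= yD => -[].
Qed.

End cdf_determines_function.

(** * Limits of convergent word sequences *)

Lemma limit_function_cvg (R : realType) (f : R -> R) (w : nat -> word) :
  limit_space f -> word_sequence w ->
  (forall e, 0 < e -> \forall n \near \oo, close_to_cdf (cdf f) (w n) e) ->
  converges_to w f.
Proof.
move=> Wf Hw Hc u; rewrite fun_density_cdf//.
exact: (word_density_cvg (slope_unit_cdf Wf) (nested_tails_cdf Wf) Hw Hc).
Qed.

Lemma limit_function_words (R : realType) (f : R -> R) : limit_space f ->
  exists w : nat -> word, [/\ word_sequence w, converges_to w f &
    forall x, 0 <= x <= 1 -> word_cdf (w n) x @[n --> \oo] --> cdf f x].
Proof.
move=> Wf; pose w n := rounded_word (cdf f) n.+1.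
have sw n : size (w n) = n.+1 by rewrite size_mkseq.
have Hw : word_sequence w.
  rewrite /word_sequence; under eq_fun do rewrite sw.
  exact: cvg_comp (cvg_addnl 1%N) cvg_id.
have Hc n : close_to_cdf (cdf f) (w n) n.+1%:R^-1.
  exact: rounded_word_close (cdf0 f) (slope_unit_cdf Wf).
have Hinv e : 0 < e -> \forall n \near \oo, n.+1%:R^-1 <= e :> R.
  move=> e0; have := near_infty_natSinv_lt (PosNum e0).
  by apply: filterS => n /ltW.
exists w; split=> //.
  apply: limit_function_cvg => // e /Hinv.
  by apply: filterS => n ne i ni; rewrite (le_trans (Hc n i ni)).
move=> x x01; apply/cvgrPdist_le => e e0.
have /Hinv : 0 < e / 2 by rewrite divr_gt0.
apply: filterS => n ne; rewrite distrC.
have /andP[x0 x1] := x01; have n0 : 0 < n.+1%:R :> R by rewrite ltr0n.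
have xn0 : 0 <= x * n.+1%:R by rewrite mulr_ge0// ltW.
rewrite /word_cdf sw; set m := Num.truncn (x * n.+1%:R).
have /andP[m1 m2] : m%:R <= x * n.+1%:R < m.+1%:R := truncn_itv xn0.
have mn : (m <= n.+1)%N.
  by rewrite -(ler_nat R) (le_trans m1)// ler_piMl// ltW.
have := Hc n m; rewrite sw => /(_ mn).
have y0 : 0 <= m%:R / n.+1%:R :> R by rewrite divr_ge0.
have yx : m%:R / n.+1%:R <= x by rewrite ler_pdivrMr.
have xy : x - m%:R / n.+1%:R <= n.+1%:R^-1.
  rewrite lerBlDr -[X in _ <= X + _]mul1r -mulrDl ler_pdivlMr//.
  by rewrite addrC natr1 ltW.
have /andP[] := slope_unit_cdf Wf y0 yx x1.
rewrite !ler_norml; move: xy ne; set r := m%:R / _; move: n.+1%:R^-1 (cdf f r).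
by move: (prefix_freq _ _ _ _) (cdf f x) => p c t c'; lra.
Qed.

(** The densities of the words [w m] and [w n] get close as [m] and [n] grow
    independently, hence so do their distribution functions. *)
Lemma word_cdf_cvg (R : realType) (w : nat -> word) (x : R) :
  word_sequence w -> convergent R w -> 0 <= x <= 1 ->
  cvgn (fun n => word_cdf (w n) x).
Proof.
move=> Hw cw x01; apply/cauchy_cvgP; apply: cauchy_exP => e e0.
pose D : set_system (nat * nat) := filter_prod \oo \oo.
have D1 : (fun p : nat * nat => size (w p.1)) @ D --> \oo.
  exact: cvg_comp (@cvg_fst _ _ \oo \oo _) Hw.
have D2 : (fun p : nat * nat => size (w p.2)) @ D --> \oo.
  exact: cvg_comp (@cvg_snd _ _ \oo \oo _) Hw.
have D12 u : word_density R u (w p.1) - word_density R u (w p.2) @[p --> D] --> (0 : R).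
  have [l Hl] : exists l : R, word_density R u (w n) @[n --> \oo] --> l.
    by exists (lim (word_density R u (w n) @[n --> \oo])); exact: cw.
  rewrite -[X in _ --> X](subrr l).
  apply: cvgB; first exact: cvg_comp (@cvg_fst _ _ \oo \oo _) Hl.
  exact: cvg_comp (@cvg_snd _ _ \oo \oo _) Hl.
have H : word_cdf (w p.1) x - word_cdf (w p.2) x @[p --> D] --> (0 : R).
  exact: word_cdf_determined.
have /cvgrPdist_lt/(_ _ e0) := H.
case=> -[A B] /= [[N1 _ HN1] [N2 _ HN2]] HAB.
exists (word_cdf (w N1) x); exists N2 => // n /= n2.
have /= := HAB (N1, n) (conj (HN1 _ (leqnn N1)) (HN2 _ n2)).
by rewrite sub0r normrN.
Qed.

Theorem theorem3 (R : realType) :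
  (forall w : nat -> word, word_sequence w -> convergent R w ->
     exists2 f : R -> R, limit_space f /\ converges_to w f &
       forall g : R -> R, limit_space g -> converges_to w g ->
         f = g %[ae @completed_lebesgue_measure R in `[0, 1]%classic]) /\
  (forall f : R -> R, limit_space f ->
     exists w : nat -> word, word_sequence w /\ converges_to w f).
Proof.
split; last by move=> f /limit_function_words[w [? ? _]]; exists w.
move=> w Hw cw.
have cF x : 0 <= x <= 1 -> cvgn (fun n => word_cdf (w n) x : R).
  exact: word_cdf_cvg.
pose F x : R := lim (word_cdf (w n) x @[n --> \oo]).
have FE x : 0 <= x <= 1 -> word_cdf (w n) x @[n --> \oo] --> F x by move/cF.
have HF : slope_unit F.
  move=> x y x0 xy y1.
  have cxy : word_cdf (w n) y - word_cdf (w n) x @[n --> \oo] --> F y - F x.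
    by apply: cvgB; apply: FE; rewrite ?x0 ?y1 ?(le_trans x0)// (le_trans xy).
  have Hs : \forall n \near \oo,
      0 <= word_cdf (w n) y - word_cdf (w n) x <= y - x + (size (w n))%:R^-1.
    apply: filterS (word_sequence_ge 1 Hw) => n n0; exact: word_cdf_slope.
  apply/andP; split.
    apply: ler_cvg_to (cvg_cst 0) cxy _.
    by apply: filterS Hs => n /andP[].
  apply: ler_cvg_to cxy _ _ ; last by apply: filterS Hs => n /andP[_]; exact.
  rewrite -[X in _ --> X]addr0; apply: cvgD; first exact: cvg_cst.
  exact: cvg_natr_inv Hw.
have F0 : F 0 = 0.
  rewrite /F (_ : (fun n => _) = cst 0) ?lim_cst//; apply/funext => n.
  by rewrite /word_cdf mul0r truncn0 /prefix_freq take0 mul0r.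
have [f [Wf fF]] := cdf_density HF F0.
have wf : converges_to w f.
  apply: limit_function_cvg => //.
  apply: close_to_cdf_pointwise => //; first exact: slope_unit_cdf.
  by move=> x x01; rewrite fF//; exact: FE.
exists f => // g Wg wg.
apply: cdf_determines_function => // x x01.
have [v [Hv vg vF]] := limit_function_words Wg.
rewrite fF//.
have vw u : word_density R u (v n) - word_density R u (w n) @[n --> \oo] --> (0 : R).
  rewrite -[X in _ --> X](subrr (fun_density u g)).
  exact: cvgB (vg u) (wg u).
apply/eqP; rewrite -subr_eq0 -oppr_eq0 opprB; apply/eqP.
exact: cvg_unique (cvgB (vF x x01) (FE x x01)) (word_cdf_determined Hv Hw vw x01).
Qed.
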